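(* Let $F:\mathbb{R}^n\to\mathbb{R}^n$ be a continuous vector field, and suppose that the dynamics $\dot{x}=F(x)$ generate an invertible and nonsingular flow $\varphi^t$. Let $X\subset\mathbb{R}^n$ be a compact set that is forward invariant or backward invariant under $\varphi^t$. Let the sample points $x_1,x_2,\dots$ be uniformly randomly distributed in $X$ and, for a sampling period $T_s>0$, let $y_k=\varphi^{T_s}(x_k)$ (no measurement noise). Let $p_1,p_2,\dots$ be linearly independent continuously differentiable basis functions whose span is dense in $L^2(X)$ and which contain the coordinate functions: for every $j\in\{1,\dots,n\}$ there is an index $l=l(j)$ with $p_{l}(x)=x_j$. For $K\ge N\geq \max_j l(j)$, apply the main lifting algorithm (described in the context) to the data pairs $\{(x_k,y_k)\}_{k=1}^K$ with the basis functions $p_1,\dots,p_N$, obtaining the estimates $\hat w_k^j$ ($1\le k\le N$, $1\le j\le n$) and the estimated vector field components $\hat F_j=\sum_{k=1}^N \hat w_k^j\,p_k$. Then, for every $j\in\{1,\dots,n\}$, with probability one, $$\lim_{N\to\infty}\ \lim_{K\to\infty}\ \lim_{T_s\to 0}\ \left\|\hat F_j-F_j\right\|=0,$$ where $\|\cdot\|$ is the norm of $L^2(X)$ (the limit $T_s\to0$ is taken first, then $K\to\infty$, then $N\to\infty$). Moreover, suppose that the basis functions $p_k$ are the monomials in $x_1,\dots,x_n$, and that the vector field is of the form $F(x)=\sum_{k=1}^{N_F} w_k\,p_k(x)$ with $w_k=(w_k^1,\dots,w_k^n)^T\in\mathbb{R}^n$, where $p_1,\dots,p_{N_F}$ are the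 monomials of total degree at most $m_F$ and $N_F=(m_F+n)!/(m_F!\,n!)$. Then for all $N\ge N_F$ (with the coordinate functions among $p_1,\dots,p_N$, and $K\ge N$) and all $j\in\{1,\dots,n\}$, with probability one, $$\lim_{T_s\to0}\hat w_k^j=w_k^j,\qquad k=1,\dots,N_F.$$
   Context: Flow: $t\mapsto\varphi^t(x_0)$ is the solution of $\dot x=F(x)$ with initial condition $x_0$. Let $\mu$ be the Lebesgue measure on $\mathbb{R}^n$. The flow is nonsingular if $\mu(A)\ne0$ implies $\mu(\varphi^t(A))\neq 0$ for all (measurable) $A\subset\mathbb{R}^n$ and all $t>0$. It is invertible if each $\varphi^t$ is invertible, with inverse $\varphi^{-t}$. The set $X$ is forward invariant if $\varphi^t(X)\subseteq X$ for all $t>0$, and backward invariant if $\varphi^{-t}(X)\subseteq X$ for all $t>0$. When $X$ is only backward invariant, the convention is that every function $f$ in the function space $L^2(X)$ (including the basis functions) is set to $f(x)=0$ for $x\notin X$. ''Uniformly randomly distributed in $X$'' means that the $x_k$ are independent and distributed according to the normalized Lebesgue measure on $X$ (with $\mu(X)>0$). The sample points do not depend on $T_s$. Main lifting algorithm. Given data pairs $\{(x_k,y_k)\}_{k=1}^K$, the sampling period $T_s$, and basis functions $p_1,\dots,p_N$ with $K\ge N$: 1. With $p(x)=(p_1(x),\dots,p_N(x))^T$, form the $K\times N$ matrices $P_x$ and $P_y$ whose $k$-th rows are $p(x_k)^T$ and $p(y_k)^T$, respectively. 2. Compute the $N\times N$ matrix $$\overline{L}_{data}=\frac1{T_s}\log\left(P_x^\dagger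 P_y\right),$$ where $\dagger$ denotes the Moore–Penrose pseudoinverse and $\log$ the principal matrix logarithm. 3. For $j=1,\dots,n$ and $k=1,\dots,N$, set $\hat w_k^j=[\overline{L}_{data}]_{kl}$, where $l$ is the index such that $p_l(x)=x_j$. The limits are understood in the sense that the quantities are defined when the parameters are sufficiently close to their limits (in particular, the logarithm for $T_s$ small enough). *)

(* Defs.v *)
From HB Require Import structures.
From mathcomp Require Import all_boot all_order all_algebra finmap.
From mathcomp Require Import complex.
From mathcomp Require Import all_classical all_reals all_analysis.
Import Order.TTheory GRing.Theory Num.Theory.
Import numFieldNormedType.Exports.

Set Implicit Arguments.
Unset Strict Implicit.
Unset Printing Implicit Defensive.

Local Open Scope classical_set_scope.
Local Open Scope ring_scope.

(* R^n is 'rV[R]_n, with the product sigma-algebra of the Borel sets of R,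
   which coincides with the Borel sigma-algebra. *)
Definition rV_display : measure_display.
Proof. exact: default_measure_display. Qed.

Section measurable_rV.
Context {R : realType} (n : nat).

Let coors (i : 'I_n) (v : 'rV[R]_n) : measurableTypeR R := v ord0 i.

Let rV_set0 : g_sigma_preimage coors set0.
Proof. exact: sigma_algebra0. Qed.

Let rV_setC A : g_sigma_preimage coors A -> g_sigma_preimage coors (~` A).
Proof. exact: sigma_algebraC. Qed.

Let rV_bigcup (A : (set 'rV[R]_n)^nat) :
  (forall i, g_sigma_preimage coors (A i)) ->
  g_sigma_preimage coors (\bigcup_i (A i)).
Proof. exact: sigma_algebra_bigcup. Qed.

HB.instance Definition _ := @isMeasurable.Build rV_display
  'rV[R]_n (g_sigma_preimage coors) rV_set0 rV_setC rV_bigcup.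

End measurable_rV.

Section lebesgue_rV.
Context {R : realType}.

Lemma measurable_coord n (i : 'I_n) :
  measurable_fun [set: 'rV[R]_n] (fun v => v ord0 i : measurableTypeR R).
Proof.
move=> _ Y mY; rewrite setTI; apply: sub_sigma_algebra => /=.
rewrite -bigcup_seq/=; exists i => /=; first by rewrite mem_index_enum.
by exists Y => //; rewrite setTI.
Qed.

Lemma measurable_fun_rV d (T : measurableType d) n (f : T -> 'rV[R]_n) :
  (forall i, measurable_fun [set: T]
     (fun t => f t ord0 i : measurableTypeR R)) ->
  measurable_fun [set: T] f.
Proof.
move=> mf _ B mB; rewrite setTI.
suff : measurable `<=` image_set_system [set: T] f measurable.
  by move/(_ B mB); rewrite /image_set_system /= setTI.
apply: smallest_sub.
  exact/sigma_algebra_image/sigma_algebra_measurable.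
rewrite -bigcup_seq => A [i _ [C mC <-]].
rewrite /image_set_system /= !setTI.
by have := mf i measurableT C mC; rewrite setTI.
Qed.

Definition cons_rV n (z : measurableTypeR R * 'rV[R]_n) : 'rV[R]_n.+1 :=
  \row_i oapp (fun j => z.2 ord0 j) z.1 (unlift ord0 i).

Definition uncons_rV n (v : 'rV[R]_n.+1) : measurableTypeR R * 'rV[R]_n :=
  (v ord0 ord0, \row_j v ord0 (lift ord0 j)).

Lemma cons_rVK n : cancel (@cons_rV n) (@uncons_rV n).
Proof.
move=> [a v]; rewrite /uncons_rV /cons_rV mxE unlift_none; congr pair.
by apply/rowP => j; rewrite !mxE liftK.
Qed.

Lemma measurable_cons_rV n : measurable_fun [set: _] (@cons_rV n).
Proof.
apply: measurable_fun_rV => i.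
case: (unliftP ord0 i) => [j ->|->].
  rewrite [X in measurable_fun _ X](_ : _ =
      (fun v : 'rV[R]_n => v ord0 j : measurableTypeR R) \o snd).
    by apply: measurableT_comp => //; exact: measurable_coord.
  by apply/funext => z; rewrite /cons_rV mxE liftK.
rewrite [X in measurable_fun _ X](_ : _ = fst)//.
by apply/funext => z; rewrite /cons_rV mxE unlift_none.
Qed.

Lemma measurable_uncons_rV n : measurable_fun [set: _] (@uncons_rV n).
Proof.
apply/measurable_fun_pairP; split; first exact: measurable_coord.
apply: measurable_fun_rV => i.
rewrite [X in measurable_fun _ X](_ : _ = fun v : 'rV[R]_n.+1 =>
    v ord0 (lift ord0 i) : measurableTypeR R); first exact: measurable_coord.
by apply/funext => v; rewrite /= mxE.
Qed.

Section step.
Variables (n : nat) (mu : {sigma_finite_measure set 'rV[R]_n -> \bar R}).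

Definition lebesgue_rV_step : set 'rV[R]_n.+1 -> \bar R :=
  pushforward (@lebesgue_measure R \x mu)%E (@cons_rV n).

Let mcons A : measurable A -> measurable (@cons_rV n @^-1` A).
Proof. by move=> mA; rewrite -[X in measurable X]setTI; exact: measurable_cons_rV. Qed.

Let step0 : lebesgue_rV_step set0 = 0%E.
Proof. by rewrite /lebesgue_rV_step /pushforward preimage_set0 measure0. Qed.

Let step_ge0 A : (0 <= lebesgue_rV_step A)%E.
Proof.
by apply: integral_ge0 => z _; exact: measure_ge0.
Qed.

Let step_sigma_additive : semi_sigma_additive lebesgue_rV_step.
Proof.
move=> A mA tA mUA; rewrite /lebesgue_rV_step /pushforward preimage_bigcup.
apply: measure_semi_sigma_additive.
- by move=> i; exact: mcons.
- by apply/trivIsetP => i j _ _ ij; rewrite -preimage_setI;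
    move/trivIsetP : tA => /(_ _ _ Logic.I Logic.I ij) ->;
    rewrite preimage_set0.
- by rewrite -preimage_bigcup; exact: mcons.
Qed.

HB.instance Definition _ := isMeasure.Build _ _ _ lebesgue_rV_step
  step0 step_ge0 step_sigma_additive.

Let step_sigma_finite : sigma_finite setT lebesgue_rV_step.
Proof.
have /sigma_finiteP[A [TA ndA Aoo]] := sigma_finiteT (@lebesgue_measure R).
have /sigma_finiteP[B [TB ndB Boo]] := sigma_finiteT mu.
exists (fun k => @uncons_rV n @^-1` (A k `*` B k)).
  rewrite -preimage_bigcup (_ : \bigcup_k _ = setT) ?preimage_setT//.
  apply/seteqP; split => // -[a v] _.
  have [k _ Aka] : (\bigcup_k A k) a by rewrite -TA.
  have [m _ Bmv] : (\bigcup_k B k) v by rewrite -TB.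
  exists (maxn k m) => //; split => /=.
    by move: a Aka; exact/subsetPset/ndA/leq_maxl.
  by move: v Bmv; exact/subsetPset/ndB/leq_maxr.
move=> k; have [mA Ak] := Aoo k; have [mB Bk] := Boo k; split.
  rewrite -[X in measurable X]setTI; apply: measurable_uncons_rV => //.
  exact: measurableX.
rewrite /lebesgue_rV_step /pushforward (_ : _ @^-1` _ = A k `*` B k).
  by rewrite product_measure1E// lte_mul_pinfty// ge0_fin_numE.
rewrite -comp_preimage (_ : _ \o _ = id) ?preimage_id//.
by apply/funext => z; exact: cons_rVK.
Qed.

HB.instance Definition _ := Measure_isSigmaFinite.Build _ _ _ lebesgue_rV_step
  step_sigma_finite.

End step.

Fixpoint lebesgue_rV n : {sigma_finite_measure set 'rV[R]_n -> \bar R} :=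
  match n with
  | 0 => \d_(0 : 'rV[R]_0)
  | n'.+1 => lebesgue_rV_step (lebesgue_rV n')
  end.

End lebesgue_rV.

Lemma lebesgue_rV_box (R : realType) n (A : 'I_n -> set (measurableTypeR R)) :
  (forall i, measurable (A i)) ->
  lebesgue_rV n [set v : 'rV[R]_n | forall i, A i (v ord0 i)] =
  (\prod_(i < n) lebesgue_measure (A i))%E.
Proof.
elim: n A => [|n IH] A mA.
  rewrite big_ord0 /= /dirac indicE mem_set//.
  by case.
have mB : measurable
    [set v : 'rV[R]_n | forall i, A (lift ord0 i) (v ord0 i)].
  rewrite (_ : [set _ | _] = \big[setI/setT]_(i < n)
      ((fun v : 'rV[R]_n => v ord0 i : measurableTypeR R) @^-1`
       A (lift ord0 i))).
    apply: bigsetI_measurable => i _; rewrite -[X in measurable X]setTI.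
    exact: measurable_coord.
  by rewrite -bigcap_seq; apply/seteqP; split => v /= Hv i => [_|];
    [exact: Hv | apply: (Hv i); rewrite /= mem_index_enum].
rewrite big_ord_recl -IH// -product_measure1E//=.
rewrite /lebesgue_rV_step /pushforward; congr (_ _).
apply/seteqP; split => -[a v] /=.
  move=> H; split => [|i]; first by have := H ord0; rewrite mxE unlift_none.
  by have := H (lift ord0 i); rewrite mxE liftK.
move=> [Aa Av] i; rewrite mxE.
by case: (unliftP ord0 i) => [j|] ->; rewrite ?liftK ?unlift_none //=.
Qed.

Section analysis_rV.
Context {R : realType} {n : nat}.
Local Notation V := 'rV[R]_n.

Definition continuously_differentiable (f : V -> R) :=
  (forall x, differentiable f x) /\
  (forall v, continuous (fun x => 'D_v f x)).

(* Norm of L^2(X); only the values of f on X matter. *)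
Definition L2norm (X : set V) (f : V -> R) : \bar R :=
  'N[lebesgue_rV n]_2%:E [EFin \o (f \_ X)].

Definition inL2 (X : set V) (f : V -> R) :=
  measurable_fun X f /\ (L2norm X f < +oo)%E.

Definition lin_indep_L2 (X : set V) (p : nat -> V -> R) :=
  forall N (c : 'I_N -> R),
    L2norm X (fun x => \sum_(k < N) c k * p k x) = 0%E -> forall k, c k = 0.

Definition span_dense_L2 (X : set V) (p : nat -> V -> R) :=
  forall f, inL2 X f -> forall e : R, 0 < e ->
    exists N (c : 'I_N -> R),
      (L2norm X (fun x => f x - \sum_(k < N) c k * p k x)%R < e%:E)%E.

Definition is_solution (F : V -> V) (x0 : V) (u : R -> V) :=
  u 0 = x0 /\ forall t : R, is_derive t 1 u (F (u t)).

Definition generates_flow (F : V -> V) (phi : R -> V -> V) :=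
  forall x0, is_solution F x0 (fun t => phi t x0) /\
    forall u, is_solution F x0 u -> forall t, u t = phi t x0.

Definition invertible_flow (phi : R -> V -> V) :=
  forall t, cancel (phi t) (phi (- t)).

Definition nonsingular_flow (phi : R -> V -> V) :=
  forall (A : set V) (t : R), measurable A -> 0 < t ->
    lebesgue_rV n A != 0%E -> lebesgue_rV n (phi t @` A) != 0%E.

Definition forward_invariant (phi : R -> V -> V) (X : set V) :=
  forall t : R, 0 < t -> phi t @` X `<=` X.

Definition backward_invariant (phi : R -> V -> V) (X : set V) :=
  forall t : R, 0 < t -> phi (- t) @` X `<=` X.

(* Functions of L^2(X) as evaluated on the data: they vanish outside X when X
   is only backward invariant. *)
Definition L2ext (phi : R -> V -> V) (X : set V) (f : V -> R) : V -> R :=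
  if `[< forward_invariant phi X >] then f else f \_ X.

End analysis_rV.

Section sampling.
Context {R : realType} {d d' : measure_display} {Omega : measurableType d}
  {T : measurableType d'} (P : probability Omega R).

Definition mutually_independent (x : nat -> {RV P >-> T}) :=
  forall (J : {fset nat}) (A : nat -> set T), (forall k, measurable (A k)) ->
    P (\bigcap_(k in [set` J]) (x k @^-1` A k)) =
    (\prod_(k <- J) P (x k @^-1` A k))%E.

End sampling.
Arguments mutually_independent {R d d' Omega T} P x.

Definition uniformly_distributed {R : realType} {n : nat} {d : measure_display}
    {Omega : measurableType d} (P : probability Omega R)
    (X : set 'rV[R]_n) (x : {RV P >-> 'rV[R]_n}) :=
  forall A : set 'rV[R]_n, measurable A ->
    distribution P x A = (lebesgue_rV n (A `&` X) / lebesgue_rV n X)%E.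
Arguments uniformly_distributed {R n d Omega} P X x.

Section matrix_functions.
Context {R : realType}.

Definition is_pinv K N (A : 'M[R]_(K, N)) (B : 'M[R]_(N, K)) :=
  [/\ A *m B *m A = A, B *m A *m B = B,
      (A *m B)^T = A *m B & (B *m A)^T = B *m A].

(* Moore-Penrose pseudoinverse: the unique B satisfying is_pinv A B. *)
Definition pinv K N (A : 'M[R]_(K, N)) : 'M[R]_(N, K) :=
  xget 0 [set B | is_pinv A B].

Definition mxexp N (A : 'M[R]_N) : 'M[R]_N :=
  limn (series (fun k => (k`!%:R)^-1 *: A ^+ k)).

(* L is the principal logarithm of A: exp L = A and the complex eigenvalues of
   L lie in the open strip |Im z| < pi. Such an L is unique; it exists iff A
   has no eigenvalue on the closed negative real half-line. *)
Definition is_principal_log N (A L : 'M[R]_N) :=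
  mxexp L = A /\
  forall z : R[i], eigenvalue (map_mx (real_complex R) L) z ->
    `|complex.Im z| < pi.

Definition has_principal_log N (A : 'M[R]_N) := exists L, is_principal_log A L.

Definition mxlog N (A : 'M[R]_N) : 'M[R]_N :=
  xget 0 [set L | is_principal_log A L].

End matrix_functions.

Section lifting.
Context {R : realType} {n : nat}.
Local Notation V := 'rV[R]_n.

Definition basis_mx (p : nat -> V -> R) K N (z : nat -> V) : 'M[R]_(K, N) :=
  \matrix_(k < K, i < N) p i (z k).

Definition koopman_mx (p : nat -> V -> R) K N (x y : nat -> V) : 'M[R]_N :=
  pinv (basis_mx p K N x) *m basis_mx p K N y.

Definition Ldata (p : nat -> V -> R) (Ts : R) K N (x y : nat -> V) : 'M[R]_N :=
  Ts^-1 *: mxlog (koopman_mx p K N x y).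

(* Entry (k, l) of Ldata; l is a natural number, and the value is meaningful
   only if l < N. *)
Definition w_hat (p : nat -> V -> R) (Ts : R) K N (x y : nat -> V)
    (l : nat) (k : 'I_N) : R :=
  if insub l is Some i then Ldata p Ts K N x y k i else 0.

Definition F_hat (p : nat -> V -> R) (Ts : R) K N (x y : nat -> V)
    (l : nat) (z : V) : R :=
  \sum_(k < N) w_hat p Ts K x y l k * p k z.

End lifting.

(* lim_(N -> oo) lim_(K -> oo) lim_(T -> 0+) e N K T = a, with the inner limits
   existing for K, resp. N, large enough. *)
Definition iterated_lim {R : realType} (e : nat -> nat -> R -> \bar R)
    (a : \bar R) :=
  exists (b : nat -> nat -> \bar R) (c : nat -> \bar R),
  [/\ \forall N \near \oo, \forall K \near \oo, e N K T @[T --> 0^'+] --> b N K,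
      \forall N \near \oo, b N K @[K --> \oo] --> c N
    & c N @[N --> \oo] --> a].

Definition monomial {R : realType} {n : nat} (m : {ffun 'I_n -> nat})
    (x : 'rV[R]_n) : R :=
  \prod_(i < n) x ord0 i ^+ m i.

Definition total_degree {n : nat} (m : {ffun 'I_n -> nat}) : nat :=
  (\sum_(i < n) m i)%N.

(* Main.v *)
(* On an almost sure event every sample point x_k lies in X and its trajectory
   stays in X for small positive times: when X is only backward invariant, the
   points that leave X at once form a set whose images under the flow are
   pairwise disjoint, hence a null set by nonsingularity. When the data matrix A
   = P_x has full column rank, A^+ P_y = 1 + T A^+ D + o(T) as T -> 0, where D
   holds the derivatives of the observables along F; since log(1 + M) = M +
   O(|M|^2), the estimate converges to A^+ D, whose column l(j) is the least
   squares solution A^+ F_j(x), because the derivative of the coordinate j is F_j.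
   By the strong law of large numbers the normal equations A^T A a = A^T F_j(x),
   divided by K, converge to those of the orthogonal projection of F_j on the span
   of p_1, .., p_N in L^2(X); the Gram matrix is invertible by linear
   independence, and the projection tends to F_j by density.
   For monomials the square blocks of A are almost surely invertible, since zero
   sets of nonzero polynomials are null; if F_j = A w on the data, A^+ A w = w. *)
Require Import Defs.
From HB Require Import structures.
From mathcomp Require Import all_boot all_order all_algebra finmap.
From mathcomp Require Import complex.
From mathcomp Require Import all_classical all_reals all_analysis.
From mathcomp Require Import measurable_realfun.
From mathcomp Require Import ring lra zify.
Import Order.TTheory GRing.Theory Num.Theory.
Import numFieldNormedType.Exports.

Set Implicit Arguments.
Unset Strict Implicit.
Unset Printing Implicit Defensive.

Local Open Scope classical_set_scope.
Local Open Scope ring_scope.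

(** * Matrix exponential and logarithm *)

Section mx_limits.
Context {R : realType}.

Lemma cvg_sumr (T : Type) (D : set_system T) {FD : Filter D}
    (V : normedModType R) I (r : seq I) (Q : pred I) (f : I -> T -> V)
    (a : I -> V) : (forall i, Q i -> f i t @[t --> D] --> a i) ->
  \sum_(i <- r | Q i) f i t @[t --> D] --> \sum_(i <- r | Q i) a i.
Proof.
move=> fa; elim: r => [|i r IH].
  by under eq_fun do rewrite big_nil; rewrite big_nil; exact: cvg_cst.
under eq_fun do rewrite big_cons; rewrite big_cons.
by case: (boolP (Q i)) => // Qi; apply: cvgD => //; exact: fa.
Qed.

Lemma cvg_prodr (T : Type) (D : set_system T) {FD : Filter D}
    I (r : seq I) (f : I -> T -> R) (a : I -> R) :
  (forall i, f i t @[t --> D] --> a i) ->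
  \prod_(i <- r) f i t @[t --> D] --> \prod_(i <- r) a i.
Proof.
move=> fa; elim: r => [|i r IH].
  by under eq_fun do rewrite big_nil; rewrite big_nil; exact: cvg_cst.
by under eq_fun do rewrite big_cons; rewrite big_cons; apply: cvgM.
Qed.

Lemma cvg_mxP (T : Type) (D : set_system T) {FD : Filter D} m n
    (f : T -> 'M[R]_(m, n)) (a : 'M[R]_(m, n)) :
  (f t @[t --> D] --> a) <-> (forall i j, f t i j @[t --> D] --> a i j).
Proof.
split=> [fa i j|fa].
  have c : {for a, continuous (fun M : 'M[R]_(m, n) => M i j)}.
    exact: coord_continuous.
  exact: continuous_cvg c fa.
move=> A [P aP sPA].
have : \forall t \near D, forall ij : 'I_m * 'I_n, P ij.1 ij.2 (f t ij.1 ij.2).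
  by apply: filter_forall => -[i j]; exact: (fa i j _ (aP i j)).
by apply: filterS => t Pt; apply: sPA => i j; exact: (Pt (i, j)).
Qed.

Lemma ler_mx_norm m n (A : 'M[R]_(m, n)) i j : `|A i j| <= `|A|.
Proof.
rewrite [leRHS]/Num.norm /= mx_normrE.
exact: (le_bigmax _ (fun ij : 'I_m * 'I_n => `|A ij.1 ij.2|) (i, j)).
Qed.

Lemma mx_norm_le m n (A : 'M[R]_(m, n)) (c : R) :
  0 <= c -> (forall i j, `|A i j| <= c) -> `|A| <= c.
Proof.
move=> c0 Ac; rewrite [leLHS]/Num.norm /= mx_normrE.
by apply/bigmax_leP; split => // -[i j] _; exact: Ac.
Qed.

Lemma mx_normM m n k (A : 'M[R]_(m, n)) (B : 'M[R]_(n, k)) :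
  `|A *m B| <= n%:R * `|A| * `|B|.
Proof.
apply: mx_norm_le => [|i j]; first by rewrite !mulr_ge0.
rewrite mxE (le_trans (ler_norm_sum _ _ _))//.
rewrite -mulrA mulr_natl; have := sumr_const 'I_n (`|A| * `|B|).
rewrite card_ord => <-; apply: ler_sum => l _.
by rewrite normrM ler_pM// ler_mx_norm.
Qed.

Lemma cvg_mulmx (T : Type) (D : set_system T) {FD : Filter D} m n k
    (f : T -> 'M[R]_(m, n)) (g : T -> 'M[R]_(n, k))
    (A : 'M[R]_(m, n)) (B : 'M[R]_(n, k)) :
  f t @[t --> D] --> A -> g t @[t --> D] --> B ->
  f t *m g t @[t --> D] --> A *m B.
Proof.
move=> /cvg_mxP fA /cvg_mxP gB; apply/cvg_mxP => i j.
under eq_fun do rewrite mxE.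
by rewrite mxE; apply: cvg_sumr => l _; apply: cvgM; [exact: fA|exact: gB].
Qed.

Lemma cvg_det (T : Type) (D : set_system T) {FD : Filter D} N
    (f : T -> 'M[R]_N) (A : 'M[R]_N) :
  f t @[t --> D] --> A -> \det (f t) @[t --> D] --> \det A.
Proof.
move=> /cvg_mxP fA; rewrite /determinant; apply: cvg_sumr => s _.
by apply: cvgM; [exact: cvg_cst|apply: cvg_prodr => i; exact: fA].
Qed.

Lemma cvg_invmx (T : Type) (D : set_system T) {FD : Filter D} N
    (f : T -> 'M[R]_N) (A : 'M[R]_N) : A \in unitmx ->
  f t @[t --> D] --> A -> invmx (f t) @[t --> D] --> invmx A.
Proof.
move=> Au fA; have dA : \det A != 0 by rewrite -unitfE -unitmxE.
have df : \det (f t) @[t --> D] --> \det A by exact: cvg_det.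
have nz : \forall t \near D, \det (f t) != 0.
  exact: cvgr_neq0 df dA.
have : (\det (f t))^-1 *: \adj (f t) @[t --> D] --> (\det A)^-1 *: \adj A.
  apply: cvgZ; first exact: cvgV.
  apply/cvg_mxP => i j; under eq_fun do rewrite mxE /cofactor.
  rewrite mxE /cofactor; apply: cvgM; first exact: cvg_cst.
  apply: cvg_det.
  apply/cvg_mxP => k l; under eq_fun do rewrite !mxE.
  by rewrite !mxE; move/cvg_mxP: fA; exact.
rewrite /invmx Au; apply: cvg_trans; apply: near_eq_cvg.
apply: filterS nz => t dt.
by rewrite unitmxE unitfE dt.
Qed.

End mx_limits.

Definition mx_completeNormedMod (R : realType) m n : completeNormedModType R :=
  HB.pack_for (completeNormedModType R) 'M[R]_(m, n)
    (Complete.on 'M[R]_(m, n)).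

Section mxexp_estimates.
Context {R : realType} (N : nat).
Local Notation M := 'M[R]_N.
Implicit Types A B : M.

Definition mxexp_coeff A := fun k => (k`!%:R)^-1 *: A ^+ k.

Lemma mx_normX A k : `|A ^+ k| <= (N%:R * `|A|) ^+ k.
Proof.
elim: k => [|k IH].
  rewrite !expr0; apply: mx_norm_le => // i j; rewrite mxE.
  by case: (i == j); rewrite ?normr1 ?normr0.
rewrite !exprS (le_trans (mx_normM _ _))// ler_wpM2l// mulr_ge0//.
Qed.

Lemma is_cvg_mxexp A : cvgn (series (mxexp_coeff A)).
Proof.
apply: (@normed_cvg _ (mx_completeNormedMod R N N)); apply: series_le_cvg; last first.
- exact: (is_cvg_series_exp_coeff (N%:R * `|A|)).
- move=> k; rewrite /= normrZ normfV normr_nat mulrC /exp_coeff /=.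
  by rewrite ler_wpM2r ?invr_ge0// mx_normX.
- by move=> k; rewrite /exp_coeff /= divr_ge0// exprn_ge0// mulr_ge0.
- by move=> k; exact: normr_ge0.
Qed.

Lemma mxexp_cvg A : series (mxexp_coeff A) @ \oo --> mxexp A.
Proof. exact: is_cvg_mxexp. Qed.

Lemma mxexp_cvg_shift A m :
  series (mxexp_coeff A) (k + m)%N @[k --> \oo] --> mxexp A.
Proof. by rewrite (cvg_shiftn m (series (mxexp_coeff A))); exact: mxexp_cvg. Qed.

Lemma mxexp_comm A B : A *m B = B *m A -> mxexp A *m B = B *m mxexp A.
Proof.
move=> AB.
have Ak k : A ^+ k *m B = B *m A ^+ k.
  elim: k => [|k IH]; first by rewrite expr0 mul1mx mulmx1.
  by rewrite exprS -mulmxA IH mulmxA AB mulmxA.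
have S k : series (mxexp_coeff A) k *m B = B *m series (mxexp_coeff A) k.
  rewrite /series /= mulmx_suml mulmx_sumr; apply: eq_bigr => i _.
  by rewrite -scalemxAl -scalemxAr Ak.
have l1 : series (mxexp_coeff A) k *m B @[k --> \oo] --> mxexp A *m B.
  by apply: cvg_mulmx; [exact: mxexp_cvg|exact: cvg_cst].
have l2 : B *m series (mxexp_coeff A) k @[k --> \oo] --> B *m mxexp A.
  by apply: cvg_mulmx; [exact: cvg_cst|exact: mxexp_cvg].
have := cvg_unique _ l1; apply; first exact: norm_hausdorff.
by rewrite (_ : (fun k => _) = (fun k => B *m series (mxexp_coeff A) k))//; apply/funext => k.
Qed.

Lemma mx_normXB A B (r : R) k : `|A| <= r -> `|B| <= r ->
  `|A ^+ k - B ^+ k| <= k%:R * N%:R * (N%:R * r) ^+ k.-1 * `|A - B|.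
Proof.
move=> Ar Br; have r0 : 0 <= r by exact: le_trans Ar.
elim: k => [|k IH]; first by rewrite !expr0 subrr normr0 !mul0r.
have -> : A ^+ k.+1 - B ^+ k.+1 = A *m (A ^+ k - B ^+ k) + (A - B) *m B ^+ k.
  by rewrite mulmxBr mulmxBl !exprS addrA subrK.
rewrite (le_trans (ler_normD _ _))//.
have h1 : `|A *m (A ^+ k - B ^+ k)| <=
    k%:R * N%:R * (N%:R * r) ^+ k * `|A - B|.
  rewrite (le_trans (mx_normM _ _))//.
  case: k IH => [|k] IH.
    by rewrite !expr0 subrr normr0 mulr0 !mul0r.
  apply: (@le_trans _ _ (N%:R * r * `|A ^+ k.+1 - B ^+ k.+1|)).
    by rewrite ler_wpM2r// ler_wpM2l.
  apply: le_trans (ler_wpM2l _ IH) _; first by rewrite mulr_ge0.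
  by rewrite /= [in leRHS]exprS; lra.
have h2 : `|(A - B) *m B ^+ k| <= N%:R * (N%:R * r) ^+ k * `|A - B|.
  rewrite (le_trans (mx_normM _ _))// mulrAC ler_wpM2r// ler_wpM2l//.
  by rewrite (le_trans (mx_normX _ _))// lerXn2r ?nnegrE ?mulr_ge0// ler_wpM2l.
by rewrite (le_trans (lerD h1 h2))// -natr1 /= !mulrDl mul1r.
Qed.

Lemma expn2_leq_fact k : (2 ^ k <= k.+1`!)%N.
Proof.
by elim: k => // k IH; rewrite expnS factS leq_mul.
Qed.

Lemma mxexp_lip A B (r : R) : `|A| <= r -> `|B| <= r -> N%:R * r <= 1 ->
  `|mxexp A - mxexp B - (A - B)| <= 2 * N%:R ^+ 2 * r * `|A - B|.
Proof.
move=> Ar Br Nr1; have r0 : 0 <= r by exact: le_trans Ar.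
set a := N%:R * r; have a0 : 0 <= a by rewrite mulr_ge0.
pose S A := series (mxexp_coeff A).
have bound m : `|S A m.+2 - S B m.+2 - (A - B)| <=
    2 * N%:R * a * (1 - 2^-1 ^+ m) * `|A - B|.
  elim: m => [|m IH].
    rewrite /S /series /= !big_nat_recr//= !big_geq//.
    rewrite /mxexp_coeff !fact0 !expr0 !expr1 !invr1 !scale1r !add0r.
    by rewrite opprD addrACA subrr add0r subrr normr0 subrr !mulr0 mul0r.
  have -> : S A m.+3 - S B m.+3 - (A - B) = (S A m.+2 - S B m.+2 - (A - B)) +
      (m.+2`!%:R)^-1 *: (A ^+ m.+2 - B ^+ m.+2).
    rewrite /S !(seriesSr _ m.+2) /mxexp_coeff scalerBr.
    move: (series _ _) (series _ _) (_ *: _) (_ *: _) => a1 a2 a3 a4.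
    by apply/matrixP => i j; rewrite !mxE; ring.
  rewrite (le_trans (ler_normD _ _))//.
  have -> : 2 * N%:R * a * (1 - 2^-1 ^+ m.+1) * `|A - B| =
     2 * N%:R * a * (1 - 2^-1 ^+ m) * `|A - B| +
     N%:R * a * 2^-1 ^+ m * `|A - B|.
    by rewrite exprS; field.
  apply: lerD => //; rewrite normrZ normfV normr_nat.
  apply: le_trans (ler_wpM2l _ (mx_normXB m.+2 Ar Br)) _ => //.
  rewrite !mulrA ler_wpM2r// -/a /=.
  have -> : m.+2`!%:R^-1 * m.+2%:R * N%:R * a ^+ m.+1 =
      (m.+1`!%:R)^-1 * a ^+ m * (N%:R * a) :> R.
    rewrite (factS m.+1) natrM exprSr; field.
    by rewrite !pnatr_eq0 -lt0n fact_gt0/=.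
  rewrite mulrC (_ : N%:R * N%:R * r * _ = N%:R * a * 2^-1 ^+ m); last first.
    by rewrite /a; ring.
  rewrite ler_wpM2l ?mulr_ge0//.
  rewrite -[leRHS]mulr1 ler_pM ?invr_ge0 ?exprn_ge0//.
    by rewrite exprVn lef_pV2 ?posrE ?exprn_gt0 ?ltr0n ?fact_gt0// -natrX ler_nat expn2_leq_fact.
  by rewrite exprn_ile1.
have sh C : S C m.+2 @[m --> \oo] --> mxexp C.
  by under eq_fun do rewrite -addn2; exact: mxexp_cvg_shift.
have cv : `|S A m.+2 - S B m.+2 - (A - B)| @[m --> \oo] -->
    `|mxexp A - mxexp B - (A - B)|.
  apply: cvg_norm; apply: cvgB; last exact: cvg_cst.
  by apply: cvgB.
apply: (closed_cvg [set y | y <= _] (@closed_le _ _) _ _ cv).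
apply: nearW => m /=; rewrite (le_trans (bound m))//.
rewrite ler_wpM2r// /a expr2 !mulrA -[leRHS]mulr1 ler_wpM2l ?mulr_ge0//.
Qed.

End mxexp_estimates.

Section mxlog_existence.
Context {R : realType} (N : nat).
Local Notation M := 'M[R]_N.

Lemma mxexp0 : mxexp (0 : M) = 1.
Proof.
apply: cvg_lim; first exact: norm_hausdorff.
apply: cvg_near_cst; exists 1%N => //= -[//|m] _.
rewrite /series /= big_nat_recl// big1 ?addr0.
  by rewrite fact0 invr1 scale1r expr0.
by move=> i _; rewrite exprS mul0r scaler0.
Qed.

(* A matrix logarithm is a fixed point of the contraction [L => L + A - exp L],
   whose iterates commute with everything that commutes with [A]. *)
Lemma mxexp_surj_near1 : exists2 r : R, 0 < r &
  forall A : M, `|A - 1| <= r -> exists L : M,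
    [/\ mxexp L = A, N%:R * `|L| <= 1,
        forall B, B *m A = A *m B -> B *m L = L *m B
      & `|L - (A - 1)| <= 8 * N%:R ^+ 2 * `|A - 1| ^+ 2].
Proof.
pose r : R := (4 * N.+1%:R ^+ 2)^-1.
have n1 : 1 <= N.+1%:R :> R by rewrite ler1n.
have nN : N%:R <= N.+1%:R :> R by rewrite ler_nat.
have r0 : 0 < r by rewrite invr_gt0 mulr_gt0 ?exprn_gt0.
have rE : r * (4 * N.+1%:R ^+ 2) = 1.
  by rewrite mulVf// gt_eqF// mulr_gt0 ?exprn_gt0.
have Nr2 : 2 * N%:R ^+ 2 * r <= 2^-1.
  have : N%:R ^+ 2 <= N.+1%:R ^+ 2 :> R by rewrite lerXn2r ?nnegrE.
  by move: rE r0; set x := N%:R ^+ 2; set y := N.+1%:R ^+ 2; nra.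
have Nr1 : N%:R * r <= 1.
  by move: rE r0 nN n1; set x := N%:R; set y := N.+1%:R; nra.
exists (r / 2); first by rewrite divr_gt0.
move=> A Ar.
pose U : set (mx_completeNormedMod R N N) := [set L : M | `|L| <= r /\
  forall B, B *m A = A *m B -> B *m L = L *m B].
pose f (L : mx_completeNormedMod R N N) : mx_completeNormedMod R N N :=
  L + (A - mxexp L).
have lip0 (L : M) : `|L| <= r -> `|mxexp L - 1 - L| <= 2^-1 * `|L|.
  move=> Lr; have h0 : `|0 : M| <= r by rewrite normr0 ltW.
  have := mxexp_lip Lr h0 Nr1; rewrite mxexp0 subr0 => h.
  by apply: le_trans h _; rewrite ler_wpM2r.
have fU : set_fun U U f.
  move=> L [Lr LB]; split; last first.
    move=> B BA; rewrite /f mulmxDr mulmxDl LB// mulmxBr mulmxBl BA.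
    by rewrite mxexp_comm// LB.
  rewrite /f (_ : L + _ = (A - 1) - (mxexp L - 1 - L)); last first.
    move: (mxexp L) (1 : M) => a1 a2.
    by apply/matrixP => i j; rewrite !mxE; ring.
  rewrite (le_trans (ler_normB _ _))//.
  have := lip0 _ Lr; lra.
have ctr : is_contraction (mkfun fU).
  exists (2^-1)%:nng; split => /=; first by rewrite invf_lt1 ?ltr1n.
  move=> [L L'] /= [[Lr _] [L'r _]].
  rewrite /f (_ : L + _ - _ = - (mxexp L - mxexp L' - (L - L'))).
    rewrite normrN (le_trans (mxexp_lip Lr L'r Nr1))// ler_wpM2r//.
  rewrite opprD addrACA (_ : A - mxexp L - (A - mxexp L') = - (mxexp L - mxexp L')); last first.
    move: (mxexp L) (mxexp L') => a1 a2.
    by apply/matrixP => i j; rewrite !mxE; ring.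
  by rewrite [RHS]opprB.
have clU : closed U.
  have -> : U = [set L : M | `|L| <= r] `&`
     \bigcap_(B in [set B : M | B *m A = A *m B])
       [set L : M | B *m L - L *m B = 0].
    apply/seteqP; split => L [Lr LB]; split => // B /= BA.
      by rewrite LB// subrr.
    by apply/eqP; rewrite -subr_eq0; apply/eqP; exact: LB.
  apply: closedI.
    apply: (@closed_comp _ _ (fun L : M => `|L|) [set x | x <= r]).
      by move=> L _; exact: norm_continuous.
    exact: closed_le.
  apply: closed_bigI => B _.
  apply: (@closed_comp _ _ (fun L : M => B *m L - L *m B) [set 0]).
    have c : continuous (fun L : M => B *m L - L *m B).
      move=> L Y /=; rewrite nbhs_simpl /=.
      have h : B *m x - x *m B @[x --> nbhs L] --> B *m L - L *m B.
        apply: cvgB; apply: cvg_mulmx; (exact: cvg_id || exact: cvg_cst).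
      exact: h.
    by move=> L _; exact: c.
  exact: (compact_closed (@norm_hausdorff _ M) (@compact_set1 _ (0 : M))).
have U0 : U !=set0.
  exists (0 : M); split; first by rewrite normr0 ltW.
  by move=> B _; rewrite mulmx0 mul0mx.
have [L [Lr LB] Lf] := banach_fixed_point ctr clU U0.
have expL : mxexp L = A.
  move: Lf; rewrite /= /f => /eqP; rewrite -subr_eq0 opprD addrA subrr add0r oppr_eq0 subr_eq0.
  by move/eqP.
have La : `|L| <= 2 * `|A - 1|.
  have := lip0 _ Lr; rewrite expL.
  have : `|L| <= `|A - 1| + `|A - 1 - L|.
    by rewrite -{1}(subKr (A - 1) L) ler_normB.
  lra.
exists L; split => //.
  by apply: le_trans Nr1; rewrite ler_wpM2l.
have h0 : `|0 : M| <= `|L| by rewrite normr0.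
have h1 : N%:R * `|L| <= 1 by apply: le_trans Nr1; rewrite ler_wpM2l.
have := mxexp_lip (lexx `|L|) h0 h1; rewrite mxexp0 subr0 expL distrC => h.
apply: le_trans h _.
have -> : 8 * N%:R ^+ 2 * `|A - 1| ^+ 2 =
    2 * N%:R ^+ 2 * (2 * `|A - 1|) * (2 * `|A - 1|) :> R by ring.
have c0 : 0 <= 2 * N%:R ^+ 2 :> R by rewrite mulr_ge0 ?exprn_ge0.
by rewrite -[leLHS]mulrA -[leRHS]mulrA ler_wpM2l// ler_pM.
Qed.

End mxlog_existence.

Section exp_product.
Context {R : realType}.

Definition exp_sum (T : algType R) (x : T) (n : nat) : T :=
  \sum_(0 <= k < n) (k`!%:R : R)^-1 *: x ^+ k.

Lemma exp_sumM (T : algType R) (x y : T) n : GRing.comm x y ->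
  exp_sum x n * exp_sum y n - exp_sum (x + y) n =
  \sum_(0 <= i < n) \sum_(0 <= j < n | (n - i <= j)%N)
    ((j`!%:R : R)^-1 * (i`!%:R)^-1) *: (x ^+ j * y ^+ i).
Proof.
move=> xy; pose t j i := ((j`!%:R : R)^-1 * (i`!%:R)^-1) *: (x ^+ j * y ^+ i).
have -> : exp_sum x n * exp_sum y n =
    \sum_(0 <= i < n) \sum_(0 <= j < n) t j i.
  rewrite /exp_sum mulr_sumr; apply: eq_bigr => i _.
  rewrite mulr_suml; apply: eq_bigr => j _.
  by rewrite -scalerAl -scalerAr scalerA.
have -> : exp_sum (x + y) n =
    \sum_(0 <= i < n) \sum_(0 <= j < n | (j < n - i)%N) t j i.
  transitivity (\sum_(0 <= k < n) \sum_(0 <= i < k.+1) t (k - i)%N i).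
    apply: eq_bigr => k _; rewrite exprDn_comm// scaler_sumr big_mkord.
    apply: eq_bigr => i _; rewrite -scalerMnr scalerMnl /t; congr (_ *: _).
    have ik : (i <= k)%N by rewrite -ltnS.
    have := bin_fact ik => /(congr1 (fun z => z%:R : R)).
    rewrite !natrM => <-; rewrite -[in LHS]mulr_natr; field.
    by rewrite !pnatr_eq0 -!lt0n !fact_gt0 bin_gt0 ik.
  transitivity (\sum_(0 <= k < n) \sum_(0 <= i < n | (i <= k)%N) t (k - i)%N i).
    apply: eq_big_nat => k /andP[_ kn].
    by rewrite (big_nat_widen _ _ n).
  rewrite (exchange_big_dep_nat xpredT)//=; apply: eq_big_nat => i /andP[_ ni].
  transitivity (\sum_(i <= k < n) t (k - i)%N i).
    by rewrite (big_nat_widenl i 0).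
  rewrite -{1}(add0n i) big_addn; under eq_bigr do rewrite addnK.
  by rewrite (big_nat_widen _ _ n) ?leq_subr.
rewrite -sumrB; apply: eq_bigr => i _.
rewrite [X in X - _](bigID (fun j => (j < n - i)%N)) /= [X in X - _]addrC addrK.
by apply: eq_bigl => j; rewrite -leqNgt.
Qed.

Lemma exp_sum_cvg (x : R) : exp_sum (x : R^o) n @[n --> \oo] --> expR x.
Proof.
have := @is_cvg_series_exp_coeff R x; rewrite /expR.
rewrite (_ : series _ = fun n => exp_sum (x : R^o) n)//.
apply/funext => n; apply: eq_bigr => k _.
by rewrite /exp_coeff /= mulrC.
Qed.

Lemma mxexpD n (A B : 'M[R]_n.+1) : A *m B = B *m A ->
  mxexp (A + B) = mxexp A *m mxexp B.
Proof.
move=> AB; pose N := n.+1.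
pose a := N%:R * `|A|; pose b := N%:R * `|B|.
have a0 : 0 <= a by rewrite mulr_ge0.
have b0 : 0 <= b by rewrite mulr_ge0.
have bound m : `|exp_sum A m * exp_sum B m - exp_sum (A + B) m| <=
   N%:R * (exp_sum (a : R^o) m * exp_sum (b : R^o) m - exp_sum (a + b : R^o) m).
  rewrite exp_sumM// exp_sumM; last exact: mulrC.
  rewrite (le_trans (ler_norm_sum _ _ _))// mulr_sumr; apply: ler_sum => i _.
  rewrite (le_trans (ler_norm_sum _ _ _))// mulr_sumr; apply: ler_sum => j _.
  rewrite normrZ ger0_norm ?mulr_ge0// mulrCA ler_wpM2l ?mulr_ge0//.
  rewrite (le_trans (mx_normM _ _))// -mulrA ler_wpM2l//.
  by rewrite ler_pM// mx_normX.
have c1 : exp_sum A m * exp_sum B m - exp_sum (A + B) m @[m --> \oo] -->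
    mxexp A *m mxexp B - mxexp (A + B).
  by apply: cvgB; [apply: cvg_mulmx|]; exact: mxexp_cvg.
have c2 : N%:R * (exp_sum (a : R^o) m * exp_sum (b : R^o) m -
    exp_sum (a + b : R^o) m) @[m --> \oo] --> (0 : R).
  rewrite (_ : 0 = N%:R * (expR a * expR b - expR (a + b))); last first.
    by rewrite expRD subrr mulr0.
  apply: cvgM; first exact: cvg_cst.
  by apply: cvgB; [apply: cvgM|]; exact: exp_sum_cvg.
have c3 : exp_sum A m * exp_sum B m - exp_sum (A + B) m @[m --> \oo] -->
    (0 : 'M[R]_n.+1).
  apply/norm_cvg0P; have c0 : (0 : R) @[_ --> \oo] --> (0 : R) by exact: cvg_cst.
  apply: (squeeze_cvgr _ c0 c2).
  by apply: nearW => m; rewrite /= normr_ge0 bound.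
have /eqP : mxexp A *m mxexp B - mxexp (A + B) = 0.
  by apply: cvg_unique c1 c3; exact: norm_hausdorff.
by rewrite subr_eq0 => /eqP.
Qed.

End exp_product.

Section complex_as_matrix.
Context {R : realType}.
Local Notation C := R[i].
Local Notation Re := complex.Re.
Local Notation Im := complex.Im.

(* Complex numbers are represented by real matrices of order 2, so that their
   exponentials are instances of [mxexp]. *)
Definition cmx (z : C) : 'M[R]_2 := \matrix_(i, j)
  if i == j then Re z else if i == 0 then - Im z else Im z.

Definition reim N (v : 'rV[C]_N) : 'M[R]_(2, N) := \matrix_(i, j)
  if i == 0 then Re (v 0 j) else Im (v 0 j).

Lemma ord2P (i : 'I_2) : (i = 0) + (i = 1).
Proof.
by case: i => -[|[|//]] h; [left|right]; apply/val_inj.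
Qed.

Lemma cmxD z w : cmx (z + w) = cmx z + cmx w.
Proof.
apply/matrixP => i j; rewrite !mxE; case: z => a b; case: w => c d /=.
by case: (ord2P i) => ->; case: (ord2P j) => -> //=; rewrite opprD.
Qed.

Lemma cmxM z w : cmx (z * w) = cmx z *m cmx w.
Proof.
apply/matrixP => i j; rewrite !mxE !big_ord_recl big_ord0 !mxE.
case: z => a b; case: w => c d /=.
by case: (ord2P i) => ->; case: (ord2P j) => -> /=; ring.
Qed.

Lemma cmx1 : cmx 1 = 1.
Proof.
by apply/matrixP => i j; rewrite !mxE; case: (ord2P i) => ->;
   case: (ord2P j) => -> //=; rewrite oppr0.
Qed.

Lemma cmxX z k : cmx (z ^+ k) = cmx z ^+ k.
Proof.
by elim: k => [|k IH]; rewrite ?expr0 ?cmx1// !exprS cmxM IH.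
Qed.

Lemma cmxR (a : R) : cmx (a%:C)%C = a%:M.
Proof.
by apply/matrixP => i j; rewrite !mxE; case: (ord2P i) => ->;
   case: (ord2P j) => -> //=; rewrite ?oppr0.
Qed.

Lemma cmx_comm z w : cmx z *m cmx w = cmx w *m cmx z.
Proof. by rewrite -!cmxM mulrC. Qed.

Lemma reim_eq0 N (v : 'rV[C]_N) : reim v = 0 -> v = 0.
Proof.
move=> v0; apply/rowP => j; rewrite mxE.
have := congr1 (fun M : 'M[R]_(2, N) => M 0 j) v0; rewrite !mxE /=.
have := congr1 (fun M : 'M[R]_(2, N) => M 1 j) v0; rewrite !mxE /=.
by case: (v 0 j) => a b /= -> ->.
Qed.

Lemma reimZ N z (v : 'rV[C]_N) : reim (z *: v) = cmx z *m reim v.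
Proof.
apply/matrixP => i j; rewrite !mxE !big_ord_recl big_ord0 !mxE.
case: z => a b; case: (v 0 j) => c d /=.
by case: (ord2P i) => -> /=; ring.
Qed.

Lemma reimM N (v : 'rV[C]_N) (L : 'M[R]_N) :
  reim (v *m map_mx (real_complex R) L) = reim v *m L.
Proof.
apply/matrixP => i j; rewrite !mxE.
have ReS (r : seq 'I_N) (f : 'I_N -> C) :
    Re (\sum_(k <- r) f k) = \sum_(k <- r) Re (f k).
  by apply: big_morph => // -[a b] [c d].
have ImS (r : seq 'I_N) (f : 'I_N -> C) :
    Im (\sum_(k <- r) f k) = \sum_(k <- r) Im (f k).
  by apply: big_morph => // -[a b] [c d].
case: (ord2P i) => -> /=; [rewrite ReS|rewrite ImS]; apply: eq_bigr => k _.
  by rewrite !mxE /=; case: (v 0 k) => a b /=; rewrite mulr0 subr0.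
by rewrite !mxE /=; case: (v 0 k) => a b /=; rewrite mulr0 add0r.
Qed.

Lemma mxexp_real (a : R) : mxexp (a%:M : 'M[R]_2) = (expR a)%:M.
Proof.
apply: cvg_lim; first exact: norm_hausdorff.
apply/cvg_mxP => i j.
have -> : (fun m => series (fun k => (k`!%:R)^-1 *: (a%:M : 'M[R]_2) ^+ k) m i j)
    = (fun m => exp_sum (a : R^o) m *+ (i == j)).
  apply/funext => m; rewrite /series /= summxE /exp_sum -sumrMnl.
  apply: eq_bigr => k _; rewrite mxE.
  have -> : (a%:M : 'M[R]_2) ^+ k = (a ^+ k)%:M.
    by elim: k => [|k IH]; rewrite ?expr0// !exprS IH [RHS]scalar_mxM.
  by rewrite mxE mulrnAr.
rewrite mxE; case: (i == j) => /=; last exact: cvg_cst.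
exact: exp_sum_cvg.
Qed.

Lemma mxexp_imag (b : R) :
  mxexp (cmx (0 +i* b)%C) = cmx (cos b +i* sin b)%C.
Proof.
have pw k : ((0 +i* b) ^+ k = (cos_coeff b k * k`!%:R) +i* (sin_coeff b k * k`!%:R))%C.
  rewrite /cos_coeff /sin_coeff /= -!exprnP !mulfVK ?pnatr_eq0 -?lt0n ?fact_gt0//.
  rewrite -(odd_double_half k); move: (odd k) (k./2) => [] m.
    rewrite add1n /= odd_double /= uphalf_double doubleK.
    elim: m => [|m IH]; first by rewrite expr1 !expr0; simpc.
    rewrite doubleS exprS [_ ^+ _.+1 in LHS]exprS IH; simpc; congr (_ +i* _)%C; rewrite ?exprS//; ring.
  rewrite add0n odd_double /= doubleK.
  elim: m => [|m IH]; first by rewrite !expr0; simpc.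
  rewrite doubleS exprS [_ ^+ _.+1 in LHS]exprS IH; simpc; congr (_ +i* _)%C; rewrite ?exprS//; ring.
apply: cvg_lim; first exact: norm_hausdorff.
apply/cvg_mxP => i j.
have fk k : (k`!%:R : R) != 0 by rewrite pnatr_eq0 -lt0n fact_gt0.
have E (k : nat) : ((k`!%:R)^-1 *: cmx (0 +i* b)%C ^+ k) i j =
    if i == j then cos_coeff b k else if i == 0 then - sin_coeff b k else sin_coeff b k.
  rewrite -cmxX pw !mxE /=.
  by case: (i == j); case: (i == 0); rewrite ?mulrN mulrC mulfK.
have -> : (fun m => series (fun k => (k`!%:R)^-1 *: cmx (0 +i* b)%C ^+ k) m i j)
    = (fun m => if i == j then series (cos_coeff b) m
       else if i == 0 then - series (sin_coeff b) m else series (sin_coeff b) m).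
  apply/funext => m; rewrite /series /= summxE; rewrite (eq_bigr _ (fun k _ => E k)).
  by case: (i == j); case: (i == 0) => //; rewrite sumrN.
have c1 : series (cos_coeff b) @ \oo --> cos b.
  by rewrite cos.unlock; exact: is_cvg_series_cos_coeff.
have c2 : series (sin_coeff b) @ \oo --> sin b.
  by rewrite sin.unlock; exact: is_cvg_series_sin_coeff.
by rewrite mxE /=; case: (i == j); case: (i == 0) => //; exact: cvgN.
Qed.

Definition cexp (z : C) : C := (expR (Re z) * cos (Im z) +i* (expR (Re z) * sin (Im z)))%C.

Lemma mxexp_cmx z : mxexp (cmx z) = cmx (cexp z).
Proof.
case: z => a b.
have -> : (a +i* b)%C = ((a%:C)%C + (0 +i* b)%C) by simpc.
rewrite cmxD mxexpD; last exact: cmx_comm.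
rewrite cmxR mxexp_real mxexp_imag -cmxR -cmxM; congr cmx.
by rewrite /cexp; simpc.
Qed.

Lemma cexp_neq0 z : cexp z != 0.
Proof.
apply/eqP => -[] /eqP; rewrite mulf_eq0 gt_eqF ?expR_gt0//= => /eqP c0.
move=> /eqP; rewrite mulf_eq0 gt_eqF ?expR_gt0//= => /eqP s0.
by have := cos2Dsin2 (Im z); rewrite c0 s0 expr0n /= addr0 => /eqP; rewrite eq_sym oner_eq0.
Qed.

Lemma cos_eq1 (t : R) : `|t| < 2 * pi -> cos t = 1 -> t = 0.
Proof.
move=> tpi ct; have : cos (t / 2 *+ 2) = 1.
  by rewrite -mulr_natr divfK.
rewrite cos_mulr2n cos2sin2 => s2.
have /eqP : sin (t / 2) ^+ 2 = 0 by move: s2; lra.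
rewrite sqrf_eq0 => /eqP s0.
have [t0|t0|->//] := ltrgtP t 0.
  have : 0 < sin (- (t / 2)).
    by apply: sin_gt0_pi; move: tpi; rewrite ltr_norml => /andP[]; lra.
  by rewrite sinN s0 oppr0 ltxx.
have : 0 < sin (t / 2).
  by apply: sin_gt0_pi; move: tpi; rewrite ltr_norml => /andP[]; lra.
by rewrite s0 ltxx.
Qed.

Lemma cexp_inj_strip z w : `|Im z| < pi -> `|Im w| < pi ->
  cexp z = cexp w -> z = w.
Proof.
case: z => a b; case: w => c d /= bpi dpi [] eC eS.
have eac : expR a = expR c.
  apply/eqP; rewrite -(@eqrXn2 _ 2) ?expR_ge0//; apply/eqP.
  rewrite -[LHS]mulr1 -(cos2Dsin2 b) -[RHS]mulr1 -(cos2Dsin2 d).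
  by rewrite !mulrDr -!exprMn eC eS.
have ac := expR_inj eac.
have e0 : expR a != 0 by rewrite gt_eqF ?expR_gt0.
have cc : cos b = cos d by apply: (mulfI e0); rewrite eC eac.
have ss : sin b = sin d by apply: (mulfI e0); rewrite eS eac.
have : b - d = 0.
  apply: cos_eq1; last by rewrite cosB cc ss -!expr2 cos2Dsin2.
  by rewrite (le_lt_trans (ler_normB _ _))// mulrDl mul1r ltrD.
by move=> /eqP; rewrite subr_eq0 => /eqP ->; rewrite ac.
Qed.

End complex_as_matrix.

Section mxlog.
Context {R : realType} (N : nat).
Local Notation C := R[i].
Local Notation Re := complex.Re.
Local Notation Im := complex.Im.
Local Notation cplx := (map_mx (real_complex R)).
Implicit Types L A : 'M[R]_N.

Lemma mxexp_intertwine (V : 'M[R]_(2, N)) L z :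
  V *m L = cmx z *m V -> V *m mxexp L = cmx (cexp z) *m V.
Proof.
move=> VL.
have Vk k : V *m L ^+ k = cmx z ^+ k *m V.
  elim: k => [|k IH]; first by rewrite !expr0 mulmx1 mul1mx.
  by rewrite exprS mulmxA VL -mulmxA IH mulmxA exprS.
have c1 : V *m series (mxexp_coeff L) k @[k --> \oo] --> V *m mxexp L.
  by apply: cvg_mulmx; [exact: cvg_cst|exact: mxexp_cvg].
have c2 : series (mxexp_coeff (cmx z)) k *m V @[k --> \oo] -->
    cmx (cexp z) *m V.
  by rewrite -mxexp_cmx; apply: cvg_mulmx; [exact: mxexp_cvg|exact: cvg_cst].
have := cvg_unique _ c1; apply; first exact: norm_hausdorff.
rewrite (_ : (fun k => _) = (fun k => series (mxexp_coeff (cmx z)) k *m V))//.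
apply/funext => k; rewrite /series /= mulmx_suml mulmx_sumr.
by apply: eq_bigr => i _; rewrite -scalemxAl -scalemxAr Vk.
Qed.

(* If [V = U (L - L0)] is an eigen-row of both [L] and [L0] for [z], then [U (L^k - L0^k) = k z^(k-1) V]. *)
Lemma mxexpB_eigen (U : 'M[R]_(2, N)) L L0 z : L *m L0 = L0 *m L ->
  U *m (L - L0) *m L = cmx z *m (U *m (L - L0)) ->
  U *m (L - L0) *m L0 = cmx z *m (U *m (L - L0)) ->
  U *m (mxexp L - mxexp L0) = cmx (cexp z) *m (U *m (L - L0)).
Proof.
move=> LL0; have [V EV] : exists V, V = U *m (L - L0) by eexists.
rewrite -EV => VL VL0.
have Vk k : V *m L ^+ k = cmx z ^+ k *m V.
  elim: k => [|k IH]; first by rewrite !expr0 mulmx1 mul1mx.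
  by rewrite exprS mulmxA VL -mulmxA IH mulmxA exprS.
have Lk k : L ^+ k *m (L - L0) = (L - L0) *m L ^+ k.
  have c : GRing.comm (L - L0) L.
    by rewrite /GRing.comm mulrBl mulrBr; congr (_ - _); rewrite -[LHS]LL0.
  exact: esym (commrX k c).
have Uk k : U *m (L ^+ k.+1 - L0 ^+ k.+1) = k.+1%:R *: (cmx z ^+ k *m V).
  elim: k => [|k IH]; first by rewrite !expr1 expr0 mul1mx scale1r.
  have -> : L ^+ k.+2 - L0 ^+ k.+2 =
      (L ^+ k.+1 - L0 ^+ k.+1) *m L0 + (L - L0) *m L ^+ k.+1.
    by rewrite -Lk mulmxBl mulmxBr !(exprSr _ k.+1) [RHS]addrC subrKA.
  rewrite mulmxDr !mulmxA IH -scalemxAl -mulmxA VL0 mulmxA -[cmx z ^+ k *m cmx z]exprSr.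
  by rewrite -EV Vk -[in RHS]natr1 scalerDl scale1r.
have c1 : U *m (series (mxexp_coeff L) k.+1 - series (mxexp_coeff L0) k.+1)
    @[k --> \oo] --> U *m (mxexp L - mxexp L0).
  apply: cvg_mulmx; first exact: cvg_cst.
  by apply: cvgB; under eq_fun do rewrite -addn1; exact: mxexp_cvg_shift.
have c2 : series (mxexp_coeff (cmx z)) k *m V @[k --> \oo] -->
    cmx (cexp z) *m V.
  by rewrite -mxexp_cmx; apply: cvg_mulmx; [exact: mxexp_cvg|exact: cvg_cst].
have := cvg_unique _ c1; apply; first exact: norm_hausdorff.
rewrite (_ : (fun k => _) = (fun k => series (mxexp_coeff (cmx z)) k *m V))//.
apply/funext => k; rewrite /series /= !big_nat_recl// /mxexp_coeff !expr0.
rewrite opprD addrACA subrr add0r -sumrB mulmx_sumr mulmx_suml.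
apply: eq_bigr => i _; rewrite -scalerBr -scalemxAr Uk scalerA -scalemxAl.
congr (_ *: _); rewrite factS natrM; field.
by rewrite nat1r !pnatr_eq0 -lt0n fact_gt0.
Qed.

Lemma common_eigenrow (L L0 : 'M[C]_N) : L *m L0 = L0 *m L -> L != L0 ->
  exists (u : 'rV[C]_N) z z0, [/\ u *m (L - L0) != 0,
    u *m (L - L0) *m L = z *: (u *m (L - L0)) &
    u *m (L - L0) *m L0 = z0 *: (u *m (L - L0))].
Proof.
move=> LL0 neq; pose Z := L - L0; pose W := row_base Z.
have ZL : Z *m L = L *m Z by rewrite mulmxBl mulmxBr LL0.
have ZL0 : Z *m L0 = L0 *m Z by rewrite mulmxBl mulmxBr LL0.
have st (B : 'M[C]_N) : Z *m B = B *m Z -> W *m B *m pinvmx W *m W = W *m B.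
  move=> ZB; apply: mulmxKpV; rewrite (eq_row_base Z).
  have h : (W *m B <= Z *m B)%MS by apply: submxMr; rewrite (eq_row_base Z).
  by apply: submx_trans h _; rewrite ZB submxMl.
pose K (B : 'M[C]_N) := W *m B *m pinvmx W.
have KE B v : Z *m B = B *m Z -> v *m K B *m W = v *m W *m B.
  by move=> ZB; rewrite /K -[LHS]mulmxA st// mulmxA.
have KW B : Z *m B = B *m Z -> K B *m W = W *m B by exact: st.
have Kc : K L *m K L0 = K L0 *m K L.
  apply: (row_free_inj (row_base_free Z)).
  rewrite -/W !KE// !KW//.
  by rewrite -!mulmxA LL0.
have r0 : (0 < \rank Z)%N by rewrite lt0n mxrank_eq0 subr_eq0.
have [v v0 /andP[/sub_rVP[z vz] /sub_rVP[z0 vz0]]] := common_eigenvector2 r0 Kc.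
have : (v *m W <= Z)%MS by rewrite (submx_trans (submxMl _ _))// eq_row_base.
move=> /submxP[u uE]; exists u, z, z0; rewrite -/Z -uE; split.
- by rewrite mulmx_free_eq0// row_base_free.
- by rewrite -KE// vz -scalemxAl.
- by rewrite -KE// vz0 -scalemxAl.
Qed.

Lemma principal_log_uniq_comm A L L0 : L *m L0 = L0 *m L ->
  is_principal_log A L -> is_principal_log A L0 -> L = L0.
Proof.
move=> LL0 [eL sL] [eL0 sL0]; apply/eqP; apply: contraT => neq.
have [u [z [z0 [v0 vz vz0]]]] : exists (u : 'rV[C]_N) z z0, [/\ u *m (cplx L - cplx L0) != 0,
    u *m (cplx L - cplx L0) *m cplx L = z *: (u *m (cplx L - cplx L0)) &
    u *m (cplx L - cplx L0) *m cplx L0 = z0 *: (u *m (cplx L - cplx L0))].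
  apply: common_eigenrow; first by rewrite -!map_mxM LL0.
  by apply: contra neq => /eqP/map_mx_inj ->.
move: v0 vz vz0; rewrite -map_mxB; set v := _ *m _ => v0 vz vz0.
have zpi : `|Im z| < pi by apply: sL; apply/eigenvalueP; exists v.
have z0pi : `|Im z0| < pi by apply: sL0; apply/eigenvalueP; exists v.
have rv : reim v = reim u *m (L - L0) by rewrite /v reimM.
have VL : reim v *m L = cmx z *m reim v by rewrite -reimM vz reimZ.
have VL0 : reim v *m L0 = cmx z0 *m reim v by rewrite -reimM vz0 reimZ.
have ee : cexp z = cexp z0.
  have h1 := mxexp_intertwine VL; have h2 := mxexp_intertwine VL0.
  have : cmx (cexp z) *m reim v = cmx (cexp z0) *m reim v by rewrite -h1 -h2 eL eL0.
  rewrite -!reimZ => /eqP; rewrite -subr_eq0 => /eqP h.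
  have : reim ((cexp z - cexp z0) *: v) = 0.
    rewrite -h scalerBl; apply/matrixP => i j; rewrite !mxE.
    case: (cexp z) => a b; case: (cexp z0) => c d; case: (v 0 j) => e f /=.
    by case: (i == 0) => /=; ring.
  by move/reim_eq0/eqP; rewrite scaler_eq0 (negbTE v0) orbF subr_eq0 => /eqP.
have zz : z = z0 by exact: cexp_inj_strip.
have := @mxexpB_eigen (reim u) L L0 z LL0.
rewrite -rv VL VL0 zz => /(_ erefl erefl).
rewrite eL eL0 subrr mulmx0 -reimZ => /esym/reim_eq0/eqP.
by rewrite scaler_eq0 (negbTE (cexp_neq0 _)) (negbTE v0).
Qed.

Local Notation normc := ComplexField.Normc.normc.

Lemma eigenvalue_bound L z : eigenvalue (cplx L) z -> `|Im z| <= N%:R * `|L|.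
Proof.
move=> /eigenvalueP[v vz v0].
have [i vi] : exists i, v 0 i != 0.
  apply/existsP; rewrite -negb_forall; apply: contra v0 => /forallP h.
  by apply/eqP/rowP => j; rewrite mxE; apply/eqP; exact: h.
case: (@arg_maxP _ _ _ i xpredT (fun j => normc (v 0 j)) isT) => j _ jm.
have nz : 0 < normc (v 0 j).
  apply: lt_le_trans (jm i isT); rewrite lt_neqAle; apply/andP; split.
    by rewrite eq_sym; apply: contra vi => /eqP/ComplexField.Normc.eq0_normc ->.
  by case: (v 0 i) => a b /=; exact: sqrtr_ge0.
have zle : normc z <= N%:R * `|L|.
  rewrite -(ler_pM2r nz) -ComplexField.Normc.normcM.
  have -> : z * v 0 j = \sum_k v 0 k * (L k j)%:C%C.
    have := congr1 (fun w : 'rV[C]_N => w 0 j) vz; rewrite !mxE => <-.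
    by apply: eq_bigr => k _; rewrite !mxE.
  have nS (r : seq 'I_N) (f : 'I_N -> C) :
      normc (\sum_(k <- r) f k) <= \sum_(k <- r) normc (f k).
    elim: r => [|k r IH]; first by rewrite !big_nil ComplexField.Normc.normc0.
    by rewrite !big_cons (le_trans (le_normcD _ _))// lerD2l.
  rewrite (le_trans (nS _ _))//.
  rewrite -mulrA mulr_natl.
  have := sumr_const 'I_N (`|L| * normc (v 0 j)).
  rewrite card_ord => <-; apply: ler_sum => k _.
  rewrite ComplexField.Normc.normcM mulrC ler_pM//.
  - by rewrite /= sqrtr_ge0.
  - by case: (v 0 k) => a b /=; exact: sqrtr_ge0.
  - by rewrite /= expr0n addr0 sqrtr_sqr ler_mx_norm.
  - exact: jm.
apply: le_trans zle; case: z {vz} => a b /=.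
by rewrite -sqrtr_sqr ler_wsqrtr// lerDr sqr_ge0.
Qed.

Lemma mxlog_near1 : exists2 r : R, 0 < r &
  forall A : 'M[R]_N, `|A - 1| <= r -> has_principal_log A /\
    `|mxlog A - (A - 1)| <= 8 * N%:R ^+ 2 * `|A - 1| ^+ 2.
Proof.
have [r r0 rP] := @mxexp_surj_near1 R N; exists r => // A /rP[L [eL NL LB est]].
have pL : is_principal_log A L.
  split=> // z /eigenvalue_bound zL; rewrite (le_lt_trans zL)//.
  by rewrite (le_lt_trans NL)// (lt_le_trans _ (pi_ge2 R))// ltr1n.
have hA : has_principal_log A by exists L.
split => //; rewrite (_ : mxlog A = L)//.
rewrite /mxlog; case: xgetP => [L' _ pL'|/(_ L)//].
apply: (@principal_log_uniq_comm A) => //; apply: LB.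
by have := pL'.1 => <-; rewrite -mxexp_comm.
Qed.

End mxlog.

(** * Borel sets and null sets in R^n *)

Section borel_rV.
Context {R : realType} {n : nat}.
Local Notation V := 'rV[R]_n.

Lemma measurable_box (A : 'I_n -> set (measurableTypeR R)) :
  (forall i, measurable (A i)) ->
  measurable [set v : V | forall i, A i (v ord0 i)].
Proof.
move=> mA; rewrite (_ : [set _ | _] = \big[setI/setT]_(i < n)
    ((fun v : V => v ord0 i : measurableTypeR R) @^-1` A i)).
  apply: bigsetI_measurable => i _; rewrite -[X in measurable X]setTI.
  exact: measurable_coord.
by rewrite -bigcap_seq; apply/seteqP; split => v /= Hv i => [_|];
  [exact: Hv | apply: (Hv i); rewrite /= mem_index_enum].
Qed.

Lemma open_measurable_rV (U : set V) : open U -> measurable U.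
Proof.
move=> oU.
pose box (q : 'rV[rat]_n * rat) : set V :=
  [set v | forall i, (`]ratr (q.1 ord0 i) - ratr q.2,
    ratr (q.1 ord0 i) + ratr q.2[%classic : set R) (v ord0 i)].
have mbox q : measurable (box q).
  exact: (@measurable_box (fun i => `]ratr (q.1 ord0 i) - ratr q.2,
    ratr (q.1 ord0 i) + ratr q.2[%classic) (fun i => measurable_itv _)).
have -> : U = \bigcup_q (if `[< box q `<=` U >] then box q else set0).
  apply/seteqP; split => [v Uv|v [q _]]; last first.
    by case: asboolP => // qU; exact: qU.
  move: (oU v); rewrite nbhs_ballP => /(_ Uv)[r /= r0 rU].
  have [e er] := rat_in_itvoo (divr_gt0 r0 (ltr0n R 2)).
  move: er; rewrite in_itv /= => /andP[e0 er].
  have /choice[c cP] : forall i : 'I_n, exists c : rat,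
      ratr c \in `]v ord0 i - ratr e, v ord0 i + ratr e[.
    move=> i; have h : v ord0 i - ratr e < v ord0 i + ratr e by lra.
    by have [c] := rat_in_itvoo h; exists c.
  have vq : box (\row_i c i, e) v.
    move=> i /=; rewrite mxE in_itv /=.
    by have := cP i; rewrite in_itv /= => /andP[]; lra.
  exists (\row_i c i, e) => //; rewrite ifT//; apply/asboolP => w wq.
  apply: rU; rewrite mx_norm_ball /ball_ /=.
  apply: (@le_lt_trans _ _ (2 * ratr e)); last by lra.
  apply: mx_norm_le => [|i j]; first by rewrite mulr_ge0// ltW.
  rewrite ord1 !mxE; have := wq j; have := vq j; rewrite /= !mxE !in_itv /=.
  by rewrite ler_norml => /andP[? ?] /andP[? ?]; apply/andP; split; lra.
apply: (countable_bigcupT_measurable (countableP _)) => q.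
by case: ifP.
Qed.

Lemma closed_measurable_rV (A : set V) : closed A -> measurable A.
Proof.
move=> cA; rewrite -(setCK A); apply: measurableC; apply: open_measurable_rV.
exact: closed_openC.
Qed.

Lemma compact_measurable_rV (A : set V) : compact A -> measurable A.
Proof.
move=> cA; apply: closed_measurable_rV.
by apply: compact_closed => //; exact: norm_hausdorff.
Qed.

Lemma continuous_measurable_rV (f : V -> R) : continuous f ->
  measurable_fun [set: V] (f : V -> measurableTypeR R).
Proof.
move=> cf; apply: (measurability _ (measurable_realfun.RGenOInfty.measurableE R)).
move=> _ [_ [a ->] <-]; rewrite setTI; apply: open_measurable_rV.
by apply: open_comp => [x _|]; [exact: cf|exact: interval_open].
Qed.

Lemma compact_lebesgue_fin (X : set V) : compact X -> (lebesgue_rV n X < +oo)%E.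
Proof.
move=> cX; have [M [_ MP]] := compact_bounded cX.
pose C := Num.max M 0 + 1; have MC : M < C by rewrite ltr_pwDr// le_max lexx.
have C0 : 0 <= C by rewrite addr_ge0// le_max lexx orbT.
pose B : set V := [set v | forall i, (`[- C, C]%classic : set R) (v ord0 i)].
have mB : measurable B.
  exact: (@measurable_box (fun=> `[- C, C]%classic) (fun=> measurable_itv _)).
have XB : X `<=` B.
  move=> v Xv i /=; rewrite in_itv /= -ler_norml.
  by apply: le_trans (ler_mx_norm v ord0 i) _; exact: (MP C MC v Xv).
apply: (@le_lt_trans _ _ (lebesgue_rV n B)).
  by apply: le_measure; rewrite ?inE//; exact: compact_measurable_rV.
rewrite /B (@lebesgue_rV_box _ _ (fun=> `[- C, C]%classic))//.
  pose I : set R := `[- C, C]%classic.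
  have : (0 <= lebesgue_measure I < +oo)%E.
    rewrite measure_ge0 lebesgue_measure_itv /=.
    by case: ifP => _; rewrite -?EFinD ltry.
  rewrite -/I; move: (lebesgue_measure I) => b /andP[b0 b1].
  suff /andP[] : (0 <= \prod_(i < n) b < +oo)%E by [].
  elim/big_ind : _ => [|y z /andP[y0 y1] /andP[z0 z1]|_ _].
  - by rewrite lee01 ltry.
  - by rewrite mule_ge0//= lte_mul_pinfty// ge0_fin_numE.
  - by rewrite b0.
Qed.

Lemma continuous_measurable_rVrV m (f : V -> 'rV[R]_m) : continuous f ->
  measurable_fun [set: V] f.
Proof.
move=> cf; apply: measurable_fun_rV => i; apply: continuous_measurable_rV.
move=> x; apply: (@continuous_comp _ _ _ f (fun v => v ord0 i)).
  exact: cf.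
exact: coord_continuous.
Qed.

End borel_rV.

Section monomial_zeros.
Context {R : realType}.

Lemma continuous_monomial n (m : {ffun 'I_n -> nat}) :
  continuous (@monomial R n m).
Proof.
move=> x Y /=; rewrite nbhs_simpl /=.
have h : monomial m y @[y --> nbhs x] --> monomial m x.
  rewrite /monomial; apply: cvg_prodr => i; move: (m i) => k.
  elim: k => [|k IH].
    by under eq_fun do rewrite expr0; rewrite expr0; exact: cvg_cst.
  under eq_fun do rewrite exprS; rewrite exprS; apply: cvgM => //.
  exact: coord_continuous.
exact: h.
Qed.

Lemma continuous_lincomb n I (r : seq I) (c : I -> R) (p : I -> 'rV[R]_n -> R) :
  (forall i, continuous (p i)) ->
  continuous (fun v => \sum_(i <- r) c i * p i v).
Proof.
move=> cp x Y /=; rewrite nbhs_simpl /=.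
have h : \sum_(i <- r) c i * p i y @[y --> nbhs x] --> \sum_(i <- r) c i * p i x.
  by apply: cvg_sumr => i _; apply: cvgM; [exact: cvg_cst|exact: cp].
exact: h.
Qed.

Lemma finite_roots (p : {poly R}) : p != 0 -> finite_set [set a | root p a].
Proof.
move=> p0; apply: contrapT => inf.
have [B Bp sB] := infinite_set_fset (size p) inf.
have : (size B < size p)%N.
  apply: max_poly_roots => //; last exact: fset_uniq.
  by apply/allP => a aB; exact: Bp.
by rewrite ltnNge sB.
Qed.

Lemma zero_set_measurable n (f : 'rV[R]_n -> R) : continuous f ->
  measurable [set v | f v = 0].
Proof.
move=> cf; apply: closed_measurable_rV.
apply: (@closed_comp _ _ f [set 0]); first by move=> v _; exact: cf.
exact: closed_eq.
Qed.

Definition tail_exponent n (m : {ffun 'I_n.+1 -> nat}) : {ffun 'I_n -> nat} :=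
  [ffun i => m (lift ord0 i)].

Lemma monomial_cons n (m : {ffun 'I_n.+1 -> nat}) (a : R) (v : 'rV[R]_n) :
  monomial m (cons_rV (a, v)) = a ^+ m ord0 * monomial (tail_exponent m) v.
Proof.
rewrite /monomial big_ord_recl !mxE unlift_none; congr (_ * _).
by apply: eq_bigr => i _; rewrite !mxE liftK ffunE.
Qed.

Lemma exponent_eq n (m m' : {ffun 'I_n.+1 -> nat}) :
  tail_exponent m = tail_exponent m' -> m ord0 = m' ord0 -> m = m'.
Proof.
move=> t h; apply/ffunP => i; case: (unliftP ord0 i) => [j ->|->//].
by have := congr1 (fun f : {ffun 'I_n -> nat} => f j) t; rewrite !ffunE.
Qed.

Lemma polynomial_zero_set_null n (s : seq {ffun 'I_n -> nat})
    (c : {ffun 'I_n -> nat} -> R) m0 : uniq s -> m0 \in s -> c m0 != 0 ->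
  lebesgue_rV n [set v | \sum_(m <- s) c m * monomial m v = 0] = 0%E.
Proof.
elim: n s c m0 => [|n IH] s c m0 us m0s cm0.
  have sE : s = [:: m0].
    have mE (m : {ffun 'I_0 -> nat}) : m = m0 by apply/ffunP => -[].
    case: s us m0s => [//|m [|m' s]]; first by rewrite (mE m).
    by rewrite (mE m) (mE m') /= inE eqxx.
  rewrite (_ : [set v | _] = set0) ?measure0//.
  apply/seteqP; split => v //=; rewrite sE big_seq1 /monomial big_ord0 mulr1.
  by move/eqP: cm0.
set f := fun v : 'rV[R]_n.+1 => \sum_(m <- s) c m * monomial m v.
have mf : measurable [set v | f v = 0].
  apply: zero_set_measurable; apply: continuous_lincomb => m.
  exact: continuous_monomial.
pose s' := undup (map (@tail_exponent n) s).
pose C a m' := \sum_(m <- s | tail_exponent m == m') c m * a ^+ m ord0.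
have fE a v : f (cons_rV (a, v)) = \sum_(m' <- s') C a m' * monomial m' v.
  rewrite /C; under [RHS]eq_bigr do rewrite mulr_suml.
  rewrite (exchange_big_dep xpredT)//= /f; apply: eq_big_seq => m ms.
  rewrite monomial_cons mulrA.
  under eq_bigl do rewrite eq_sym.
  rewrite -big_filter filter_pred1_uniq ?undup_uniq ?big_seq1//.
  by rewrite mem_undup; apply/mapP; exists m.
pose p := \sum_(m <- s | tail_exponent m == tail_exponent m0)
  c m *: 'X^(m ord0).
have pC a : p.[a] = C a (tail_exponent m0).
  by rewrite horner_sum; apply: eq_bigr => m _; rewrite hornerZ hornerXn.
have p0 : p != 0.
  apply/eqP => /(congr1 (fun q : {poly R} => q`_(m0 ord0))).
  rewrite coef0 coef_sum big_mkcond (bigD1_seq m0)//= eqxx.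
  rewrite coefZ coefXn eqxx mulr1 big1.
    by rewrite addr0 => /eqP; rewrite (negbTE cm0).
  move=> m mm0; case: eqP => // tm; rewrite coefZ coefXn.
  case: eqP => [h|_]; last by rewrite mulr0.
  by rewrite (exponent_eq tm (esym h)) eqxx in mm0.
have -> : lebesgue_rV n.+1 [set v | f v = 0] =
  product_measure1 (@lebesgue_measure R) (lebesgue_rV n)
    (@cons_rV R n @^-1` [set v | f v = 0]) by [].
have mZ : measurable (@cons_rV R n @^-1` [set v | f v = 0]).
  by rewrite -[X in measurable X]setTI; exact: measurable_cons_rV.
rewrite /product_measure1.
transitivity (\int[@lebesgue_measure R]_x (cst 0%E x : \bar R))%E; last first.
  exact: integral0.
apply: ge0_ae_eq_integral => //.
- exact: measurable_fun_xsection.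
- exists [set a | root p a]; split.
  + apply: countable_measurable => //; apply: finite_set_countable.
    exact: finite_roots.
  + apply: countable_lebesgue_measure0; apply: finite_set_countable.
    exact: finite_roots.
  + move=> a /= /not_implyP[_ h]; apply: contrapT => ra; apply: h.
    rewrite [in LHS](_ : xsection _ a =
        [set v | \sum_(m' <- s') C a m' * monomial m' v = 0]).
      apply: (IH s' (C a) (tail_exponent m0) (undup_uniq _)).
        by rewrite mem_undup; apply/mapP; exists m0.
      by rewrite -pC; apply/negP.
    by apply/seteqP; split => v; rewrite /xsection /= inE /= fE.
Qed.

End monomial_zeros.

(** * Flows of continuous vector fields *)

Section derivative_estimates.
Context {R : realType} {n : nat}.
Local Notation V := 'rV[R]_n.
Implicit Types (u w : R -> V) (t : R) (c : V).

Definition has_deriv u t c := forall e : R, 0 < e -> exists2 d : R, 0 < d &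
  forall h, `|h| < d -> `|u (t + h) - u t - h *: c| <= e * `|h|.

Lemma has_derivP u t c : is_derive t 1 u c <-> has_deriv u t c.
Proof.
have qE h : h != 0 -> `|c - h^-1 *: (u (h *: 1 + t) - u t)| * `|h| =
    `|u (t + h) - u t - h *: c|.
  move=> h0; rewrite distrC mulrC -normrZ scalerBr scalerA mulfV// scale1r.
  by rewrite /GRing.scale /= mulr1 (addrC h).
split=> [[du dc]|uP].
  subst c => e e0.
  have /cvgrPdist_le/(_ e e0)[d /= d0 ud] :
    h^-1 *: (u (h *: 1 + t) - u t) @[h --> 0^'] --> 'D_1 u t by exact: du.
  exists d => // h hd; have [->|h0] := eqVneq h 0.
    by rewrite addr0 subrr scale0r subr0 !normr0 mulr0.
  rewrite -qE// ler_pM2r ?normr_gt0//; apply: ud => //=.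
  by rewrite sub0r normrN.
have cv : h^-1 *: (u (h *: 1 + t) - u t) @[h --> 0^'] --> c.
  apply/cvgrPdist_le => e e0; have [d d0 ud] := uP e e0.
  exists d => //= h; rewrite /= sub0r normrN => hd h0.
  rewrite -(ler_pM2r (_ : 0 < `|h|)) ?normr_gt0// qE//.
  exact: ud.
split; first by apply/cvg_ex; exists c.
by apply: cvg_lim => //; exact: norm_hausdorff.
Qed.

Lemma has_deriv_eq_near u w t c (d : R) : 0 < d ->
  (forall h, `|h| < d -> u (t + h) = w (t + h)) -> has_deriv u t c ->
  has_deriv w t c.
Proof.
move=> d0 uw uc e /uc[d' d'0 ud']; exists (Num.min d d').
  by rewrite lt_min d0.
move=> h; rewrite lt_min => /andP[hd hd'].
have := uw 0; rewrite normr0 addr0 => /(_ d0) <-.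
by rewrite -uw//; exact: ud'.
Qed.

Lemma has_deriv_shift u t s c : has_deriv u (t + s) c ->
  has_deriv (fun r => u (r + s)) t c.
Proof.
move=> uc e /uc[d d0 ud]; exists d => // h /ud.
by rewrite (addrAC t h s).
Qed.

Lemma has_deriv_opp u t c : has_deriv u (- t) c ->
  has_deriv (fun r => u (- r)) t (- c).
Proof.
move=> uc e /uc[d d0 ud]; exists d => // h hd.
by have := ud (- h); rewrite normrN -opprD => /(_ hd); rewrite scaleNr scalerN.
Qed.

Lemma has_deriv_glue u w a t (F : V -> V) : u a = w a ->
  (t <= a -> has_deriv u t (F (u t))) -> (a <= t -> has_deriv w t (F (w t))) ->
  has_deriv (fun s => if s <= a then u s else w s) t
    (F (if t <= a then u t else w t)).
Proof.
move=> uwa du dw; have [ta|ta|ta] := ltrgtP t a.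
- apply: (@has_deriv_eq_near u _ _ _ (a - t)); first by rewrite subr_gt0.
    by move=> h; rewrite ltr_norml => /andP[_ ha]; rewrite ifT//; lra.
  exact/du/ltW.
- apply: (@has_deriv_eq_near w _ _ _ (t - a)); first by rewrite subr_gt0.
    by move=> h; rewrite ltr_norml => /andP[ha _]; rewrite ifF//; lra.
  exact/dw/ltW.
- move=> e e0.
  subst t; have [d d0 ud] := du (lexx a) e e0.
  have [d' d'0 wd] := dw (lexx a) e e0.
  exists (Num.min d d'); first by rewrite lt_min d0.
  move=> h; rewrite lt_min => /andP[hd hd']; rewrite lexx.
  case: ifP => _; first exact: ud.
  by have := wd h hd'; rewrite -uwa.
Qed.

Lemma is_derive_coord u t c i : is_derive t 1 u c ->
  is_derive t 1 (fun s => u s ord0 i) (c ord0 i).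
Proof.
move=> [du <-]; split; first by move/derivable_mxP : (du); exact.
by rewrite derive_mx// mxE.
Qed.

Lemma increment_bound u (a b : R) c (v : R -> V) (e : R) : a <= b -> 0 <= e ->
  (forall t, is_derive t 1 u (v t)) ->
  (forall t, a < t < b -> `|v t - c| <= e) ->
  `|u b - u a - (b - a) *: c| <= e * (b - a).
Proof.
move=> ab e0 du vc; apply: mx_norm_le => [|i j].
  by rewrite mulr_ge0// subr_ge0.
rewrite ord1 !mxE; case: (ltrgtP a b) ab => // [ab _|<- _]; last first.
  by rewrite !subrr mul0r subrr normr0 mulr0.
have dui t : is_derive t 1 (fun s => u s ord0 j) (v t ord0 j).
  exact: is_derive_coord.
have [s sab ->] : exists2 s, s \in `]a, b[ &
    u b ord0 j - u a ord0 j = v s ord0 j * (b - a).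
  apply: (@MVT R (fun s => u s ord0 j) (fun s => v s ord0 j)) => //.
  apply: derivable_within_continuous => t _; exact: ex_derive.
rewrite [v s _ _ * _]mulrC -mulrBr normrM (@gtr0_norm _ (b - a)) ?subr_gt0//.
rewrite [leLHS]mulrC ler_pM2r ?subr_gt0//.
apply: le_trans (vc s _); last by move: sab; rewrite in_itv.
by have := ler_mx_norm (v s - c) ord0 j; rewrite !mxE.
Qed.

Lemma solution_continuous u : (forall t, exists c, is_derive t 1 u c) ->
  continuous u.
Proof.
move=> du t; have [c uc] := du t.
by apply: differentiable_continuous; apply/derivable1_diffP; exact: ex_derive.
Qed.

End derivative_estimates.

Section flow_theory.
Context {R : realType} {n : nat}.
Local Notation V := 'rV[R]_n.
Implicit Types (F : V -> V) (phi : R -> V -> V).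

Lemma flow_deriv F phi : generates_flow F phi ->
  forall (x : V) (t : R), is_derive t 1 (fun s => phi s x) (F (phi t x)).
Proof. by move=> Fphi x t; have [[_ +] _] := Fphi x. Qed.

Lemma flow0 F phi : generates_flow F phi -> forall x, phi 0 x = x.
Proof. by move=> Fphi x; have [[]] := Fphi x. Qed.

Lemma flow_uniq F phi : generates_flow F phi -> forall u x,
  u 0 = x -> (forall t, has_deriv u t (F (u t))) -> forall t, u t = phi t x.
Proof.
move=> Fphi u x u0 du; have [_ ] := Fphi x; apply.
by split=> // t; apply/has_derivP.
Qed.

Lemma flowD F phi : generates_flow F phi ->
  forall s t x, phi (s + t) x = phi s (phi t x).
Proof.
move=> Fphi s t x.
rewrite -[LHS]/((fun r => phi (r + t) x) s); apply: (flow_uniq Fphi).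
  by rewrite add0r.
move=> r; apply: (@has_deriv_shift _ _ (fun r => phi r x)).
by apply/has_derivP; exact: flow_deriv.
Qed.

Lemma flow_reverse F phi : generates_flow F phi ->
  generates_flow (fun x => - F x) (fun t => phi (- t)).
Proof.
move=> Fphi x; split.
  split; first by rewrite oppr0 (flow0 Fphi).
  move=> t; apply/has_derivP/(@has_deriv_opp _ _ (fun s => phi s x)).
  by apply/has_derivP; exact: flow_deriv.
move=> u [u0 du] t; have := @flow_uniq _ _ Fphi (fun s => u (- s)) x.
rewrite oppr0 => /(_ u0) h; rewrite -h ?opprK// => s.
rewrite -(opprK (F _)); apply: has_deriv_opp.
by apply/has_derivP.
Qed.

Lemma ball_bounded (F : V -> V) (r : R) : continuous F ->
  exists2 M, 0 < M & forall x, `|x| <= r -> `|F x| <= M.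
Proof.
move=> cF; pose B := [set x : V | `|x| <= r].
have cB : compact B.
  apply: bounded_closed_compact.
    exists r; split; first exact: num_real.
    by move=> M rM x /= xr; rewrite (le_trans xr)// ltW.
  apply: (@closed_comp _ _ (fun x : V => `|x|) [set x | x <= r]).
    by move=> x _; exact: norm_continuous.
  exact: closed_le.
have /compact_bounded[M [_ MP]] : compact (F @` B).
  by apply: continuous_compact => //; exact: continuous_subspaceT.
exists (Num.max M 0 + 1); first by rewrite ltr_pwDr// le_max lexx orbT.
move=> x xr; apply: (MP (Num.max M 0 + 1)); last by exists x.
by rewrite ltr_pwDr// le_max lexx.
Qed.

Lemma flow_confined_ge0 F phi (r M : R) : generates_flow F phi -> 0 < M ->
  (forall x, `|x| <= r + 1 -> `|F x| <= M) ->
  forall x t, `|x| <= r -> 0 <= t -> t * M < 1 -> `|phi t x| <= r + 1.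
Proof.
move=> Fphi M0 FM x t xr t0 tM; rewrite leNgt; apply/negP => out.
pose g s := `|phi s x|.
have cphi : continuous (fun s => phi s x).
  by apply: solution_continuous => s; exists (F (phi s x)); exact: flow_deriv.
have cg : continuous g.
  by move=> s; apply: cvg_norm; exact: cphi.
pose S := `[0, t] `&` [set s | r + 1 <= g s].
have cS : compact S.
  apply: (@subclosed_compact _ _ `[0, t]).
  - apply: closedI; first exact: itv_closed.
    apply: (@closed_comp _ _ g [set s | r + 1 <= s]) => [s _|].
      exact: cg.
    exact: closed_ge.
  - exact: segment_compact.
  - by move=> s [].
have S0 : S !=set0.
  by exists t; split; [rewrite /= in_itv /= t0 lexx|exact: ltW].
have cid : {within S, continuous (@idfun R)}.
  by apply: continuous_subspaceT => y; exact: cvg_id.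
have [s sS smin] := compact_EVT_min S0 cS cid.
move: sS; rewrite inE => -[/= + rs]; rewrite in_itv /= => /andP[s0 st].
have : `|phi s x - phi 0 x - (s - 0) *: 0| <= M * (s - 0).
  apply: (increment_bound s0 (ltW M0) (flow_deriv Fphi x)) => a /andP[a0 as_].
  rewrite subr0; apply: FM; rewrite leNgt; apply/negP => h.
  suff : s <= a by lra.
  apply: smin; rewrite inE; split; last exact: ltW.
  by rewrite /= in_itv /= (ltW a0) (le_trans (ltW as_)).
rewrite scaler0 subr0 (flow0 Fphi) subr0 => h.
have : g s <= `|phi s x - x| + `|x|.
  by rewrite /g -{1}(subrK x (phi s x)) ler_normD.
have : M * s <= t * M by rewrite mulrC ler_pM2r.
by move: rs h; rewrite /g; lra.
Qed.

Lemma flow_confined F phi (r M : R) : generates_flow F phi -> 0 < M ->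
  (forall x, `|x| <= r + 1 -> `|F x| <= M) ->
  forall x t, `|x| <= r -> `|t| * M < 1 -> `|phi t x| <= r + 1.
Proof.
move=> Fphi M0 FM x t xr; have [t0|t0] := leP 0 t.
  by rewrite ger0_norm//; exact: (flow_confined_ge0 Fphi).
rewrite ltr0_norm// => tM; rewrite -(opprK t).
apply: (flow_confined_ge0 (flow_reverse Fphi) M0 _ xr) => //; last first.
  by rewrite oppr_ge0 ltW.
by move=> y /FM; rewrite normrN.
Qed.

Lemma ultra_bounded_cvg (T : Type) (U : set_system T) (f : T -> V) (C : R) :
  UltraFilter U -> U [set y | `|f y| <= C] -> exists p : V, f @ U --> p.
Proof.
move=> UU UC; pose B := [set x : V | `|x| <= C].
have cB : compact B.
  apply: bounded_closed_compact.
    exists C; split; first exact: num_real.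
    by move=> M rM x /= xr; rewrite (le_trans xr)// ltW.
  apply: (@closed_comp _ _ (fun x : V => `|x|) [set x | x <= C]).
    by move=> x _; exact: norm_continuous.
  exact: closed_le.
have [p [_ clp]] := cB (f @ U) _ UC; exists p => A Ap.
have [//|UnA] := in_ultra_setVsetC (f @^-1` A) UU.
by have [y []] := clp (~` A) A UnA Ap.
Qed.

(* Extend [v] outside the interval by the flow. *)
Lemma flow_uniq_local F phi (v : R -> V) (d : R) : generates_flow F phi ->
  (forall t, `|t| < d -> has_deriv v t (F (v t))) ->
  forall s, `|s| < d -> v s = phi s (v 0).
Proof.
move=> Fphi dv s sd; pose a := `|s|; have a0 : 0 <= a by exact: normr_ge0.
pose v1 t := if t <= a then v t else phi (t - a) (v a).
have dphi b y t : has_deriv (fun r => phi (r - b) y) t (F (phi (t - b) y)).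
  apply: (@has_deriv_shift _ _ (fun r => phi r y)).
  by apply/has_derivP; exact: flow_deriv.
have dv1 t : - d < t -> has_deriv v1 t (F (v1 t)).
  move=> dt; apply: has_deriv_glue.
  - by rewrite subrr (flow0 Fphi).
  - by move=> ta; apply: dv; rewrite ltr_norml dt /= (le_lt_trans ta).
  - by move=> _; exact: dphi.
pose v2 t := if t <= - a then phi (t - (- a)) (v1 (- a)) else v1 t.
have dv2 t : has_deriv v2 t (F (v2 t)).
  apply: (@has_deriv_glue _ _ (fun t => phi (t - (- a)) (v1 (- a)))).
  - by rewrite subrr (flow0 Fphi).
  - by move=> _; exact: dphi.
  - by move=> ta; apply: dv1; rewrite (lt_le_trans _ ta)// ltrN2.
have sa : `|s| <= a by [].
have v2E t : `|t| <= a -> v2 t = v t.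
  rewrite ler_norml => /andP[t1 t2]; rewrite /v2 /v1.
  have -> : - a <= a by rewrite (le_trans t1).
  case: ifP => ta; last by rewrite t2.
  have -> : t = - a by apply/eqP; rewrite eq_le ta t1.
  by rewrite subrr (flow0 Fphi).
rewrite -v2E// (flow_uniq Fphi erefl dv2) v2E// normr0.
exact: a0.
Qed.

(* Every limit of the trajectories [phi ^~ y] along an ultrafilter [y --> x]
   solves the same differential equation from [x], hence is [phi ^~ x]; no
   Lipschitz condition is available. *)
Lemma flow_continuous_local F phi (r M : R) : continuous F ->
  generates_flow F phi -> 0 < M ->
  (forall x, `|x| <= r + 1 -> `|F x| <= M) ->
  forall x t, `|x| < r -> `|t| * M < 1 -> {for x, continuous (phi t)}.
Proof.
move=> cF Fphi M0 FM x t xr tM.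
have conf := flow_confined Fphi M0 FM.
have key (U : set_system V) : UltraFilter U -> U --> x ->
    phi t @ U --> phi t x.
  move=> UU Ux.
  have Ur : U [set y | `|y| <= r].
    apply: Ux; apply/nbhs_ballP; exists (r - `|x|); first by rewrite /= subr_gt0.
    move=> y; rewrite mx_norm_ball /ball_ /= => xy; have : `|y| <= `|x| + `|x - y|.
      by rewrite -{1}(subKr x y) ler_normB.
    by move: xy; rewrite distrC; lra.
  have /choice[v vP] : forall s : R, exists p : V,
      `|s| * M < 1 -> phi s @ U --> p.
    move=> s; have [sM|] := boolP (`|s| * M < 1); last by exists 0.
    have [|p pP] := @ultra_bounded_cvg _ U (phi s) (r + 1) UU.
      by apply: filterS Ur => y /= yr; exact: conf.
    by exists p.
  have incr y s h (c : V) (e : R) : 0 <= e ->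
      (forall a, `|a| <= `|h| -> `|F (phi (s + a) y) - c| <= e) ->
      `|phi (s + h) y - phi s y - h *: c| <= e * `|h|.
    move=> e0 Fc; have [h0|h0] := leP 0 h.
      have := @increment_bound _ _ (fun s => phi s y) s (s + h) c
        (fun s => F (phi s y)) e.
      rewrite [s + h]addrC addrK ger0_norm//; apply => //.
      - by rewrite lerDr.
      - exact: flow_deriv.
      - move=> b /andP[b1 b2]; have -> : b = s + (b - s) by rewrite addrC subrK.
        by apply: Fc; rewrite (ger0_norm h0) ger0_norm; lra.
    have := @increment_bound _ _ (fun s => phi s y) (s + h) s c
      (fun s => F (phi s y)) e.
    rewrite ltr0_norm// opprD addNKr => h'.
    rewrite -normrN opprD opprB -scaleNr; apply: h' => //.
    - by rewrite gerDl ltW.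
    - exact: flow_deriv.
    - move=> b /andP[b1 b2]; have -> : b = s + (b - s) by rewrite addrC subrK.
      by apply: Fc; rewrite (ltr0_norm h0) ltr0_norm; lra.
  have dv s : `|s| < M^-1 -> has_deriv v s (F (v s)).
    move=> sM e e0.
    have /nbhs_ballP[rho /= rho0 Frho] :
        nbhs (v s) [set y | `|F (v s) - F y| <= e].
      by move/cvgrPdist_le: (cF (v s)); exact.
    rewrite mx_norm_ball in Frho.
    pose d := Num.min (M^-1 - `|s|) (rho / 2 / M).
    exists d; first by rewrite lt_min subr_gt0 sM !divr_gt0.
    move=> h; rewrite lt_min => /andP[h1 h2].
    have lift a : `|a| < M^-1 -> `|a| * M < 1.
      by move=> aM; rewrite -ltr_pdivlMr// div1r.
    have sh a : `|a| <= `|h| -> `|s + a| * M < 1.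
      by move=> ah; apply: lift; rewrite (le_lt_trans (ler_normD _ _))//; lra.
    have s0 : `|s| * M < 1 by exact: lift.
    have cs := vP s s0; have csh := vP (s + h) (sh h (lexx _)).
    have cv : `|phi (s + h) y - phi s y - h *: F (v s)| @[y --> U] -->
        `|v (s + h) - v s - h *: F (v s)|.
      by apply: cvg_norm; apply: cvgB; [exact: cvgB|exact: cvg_cst].
    apply: (closed_cvg [set z | z <= _] (@closed_le _ _) _ _ cv).
    have Us : U [set y | `|v s - phi s y| < rho / 2].
      by move/cvgrPdist_lt: cs; apply; rewrite divr_gt0.
    apply: filterS2 Ur Us => y /= yr ys.
    apply: (incr y); first exact: ltW.
    move=> a ah; rewrite distrC; apply: Frho => /=.
    have : `|phi (s + a) y - phi s y - a *: 0| <= M * `|a|.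
      apply: (incr y); first exact: ltW.
      move=> b ba; rewrite subr0; apply: FM; apply: conf => //.
      by apply: sh; exact: le_trans ah.
    rewrite scaler0 subr0 => h3.
    have h4 : M * `|a| < rho / 2.
      apply: (@le_lt_trans _ _ (`|h| * M)).
        by rewrite mulrC ler_pM2r.
      by rewrite -ltr_pdivlMr.
    rewrite -(subrKA (phi s y)) (le_lt_trans (ler_normD _ _))//.
    move: h3; rewrite distrC; lra.
  have tM' : `|t| < M^-1 by rewrite -[M^-1]mul1r ltr_pdivlMr.
  have M0' : `|0 : R| * M < 1 by rewrite normr0 mul0r.
  have v0 : v 0 = x.
    have c0 := vP 0 M0'.
    have : phi 0 @ U --> x.
      by rewrite (_ : phi 0 = id)//; apply/funext => y; exact: flow0 Fphi y.
    by move=> c1; apply: (cvg_unique _ c0 c1); exact: norm_hausdorff.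
  by rewrite -v0 -(flow_uniq_local Fphi dv tM'); exact: vP.
move=> A Ax; apply: contrapT => nA.
pose G := within (~` (phi t @^-1` A)) (nbhs x).
have GF : ProperFilter G.
  apply: Build_ProperFilter_ex => B GB; apply: contrapT => nB.
  apply: nA; have {}GB : nbhs x [set y | ~ A (phi t y) -> B y] by exact: GB.
  suff : nbhs x (phi t @^-1` A) by [].
  apply: filterS GB => y By.
  by apply: contrapT => nAy; apply: nB; exists y; exact: By.
have [U [UU GU]] := ultraFilterLemma GF.
have Ux : U --> x.
  by move=> B Bx; apply: GU; apply: filterS Bx => y By _.
have UA : U (phi t @^-1` A) by exact: (key U UU Ux A Ax).
have UnA : U (~` (phi t @^-1` A)).
  apply: GU; suff : nbhs x [set y | ~ A (phi t y) -> ~ A (phi t y)] by [].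
  exact: (@filterS _ _ (nbhs_filter x) setT _ (fun y _ h => h) filterT).
have : U set0 by rewrite -(setICr (phi t @^-1` A)); exact: filterI.
exact: (@filter_not_empty _ U).
Qed.

Lemma flow_continuous F phi : continuous F -> generates_flow F phi ->
  forall t, continuous (phi t).
Proof.
move=> cF Fphi t x.
have cphi : continuous (fun s => phi s x).
  by apply: solution_continuous => s; exists (F (phi s x)); exact: flow_deriv.
have /compact_bounded[C [_ CP]] : compact ((fun s => phi s x) @` `[- `|t|, `|t|]).
  apply: continuous_compact; last exact: segment_compact.
  exact: continuous_subspaceT.
pose r := C + 2.
have rP s : `|s| <= `|t| -> `|phi s x| < r.
  move=> st; apply: (@le_lt_trans _ _ (C + 1)); last by rewrite /r; lra.
  by apply: CP; [lra|exists s => //=; rewrite in_itv /= -ler_norml].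
have [M M0 FM] := ball_bounded (r + 1) cF.
have [m m0 tm] : exists2 m : nat, 0 < m%:R :> R & `|t / m%:R| * M < 1.
  exists (Num.truncn (`|t| * M)).+1; first by rewrite ltr0n.
  rewrite normrM normfV (@gtr0_norm _ _.+1%:R) ?ltr0n// mulrAC.
  by rewrite ltr_pdivrMr ?ltr0n// mul1r truncnS_gt.
have mt : m%:R * (t / m%:R) = t by rewrite mulrC divfK// gt_eqF.
suff : forall k, (k <= m)%N -> {for x, continuous (phi (k%:R * (t / m%:R)))}.
  by move=> /(_ m (leqnn _)); rewrite mt.
elim=> [_|k IH km].
  rewrite mul0r (_ : phi 0 = id); first exact: cvg_id.
  by apply/funext => y; exact: flow0 Fphi y.
have -> : phi (k.+1%:R * (t / m%:R)) =
    phi (t / m%:R) \o phi (k%:R * (t / m%:R)).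
  by apply/funext => y; rewrite /= -(flowD Fphi) -natr1 mulrDl mul1r addrC.
apply: continuous_comp; first exact/IH/ltnW.
apply: (flow_continuous_local cF Fphi M0 FM) => //.
apply: rP; rewrite mulrCA normrM ler_piMr// ger0_norm ?divr_ge0//.
by rewrite ler_pdivrMr// mul1r ler_nat ltnW.
Qed.

End flow_theory.

Section uncountable_disjoint.
Context {R : realType} {d : measure_display} {T : measurableType d}
  (mu : {sigma_finite_measure set T -> \bar R}).

Lemma uncountable_disjoint_null (A : R -> set T) :
  (forall s, measurable (A s)) ->
  (forall s t, s != t -> A s `&` A t = set0) ->
  exists2 s, 0 <= s <= 1 & mu (A s) = 0%E.
Proof.
move=> mA tA; apply: contrapT => noz.
have /sigma_finiteP[F [TF ndF Foo]] := sigma_finiteT mu.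
have mAF s k : measurable (A s `&` F k).
  by apply: measurableI => //; have [] := Foo k.
pose S k j := [set s : R | (j.+1%:R^-1%:E <= mu (A s `&` F k))%E].
have finS k j : finite_set (S k j).
  apply: contrapT => inf; have [mFk Fkoo] := Foo k.
  have Ffin : mu (F k) \is a fin_num by rewrite ge0_fin_numE.
  pose m := (Num.truncn (fine (mu (F k)) * j.+1%:R)).+1.
  have [B BS mB] := infinite_set_fset m inf.
  have : (mu (\bigcup_(s in [set` B]) (A s `&` F k)) <= mu (F k))%E.
    apply: le_measure; rewrite ?inE//; last by move=> t [s _ []].
    by apply: fin_bigcup_measurable => //; exact: finite_fset.
  rewrite measure_fin_bigcup//; last first.
    apply/trivIsetP => s t _ _ st; rewrite setIACA tA//.
    by rewrite set0I.
  apply/negP; rewrite -ltNge (fsbig_finite _ _ (finite_fset B))/= set_fsetK.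
  apply: (@lt_le_trans _ _ (\sum_(s <- B) (j.+1%:R^-1)%:E)%E); last first.
    by rewrite big_seq [leRHS]big_seq; apply: lee_sum => s /BS.
  rewrite sumEFin big_const_seq count_predT iter_addr_0 -(fineK Ffin) lte_fin.
  rewrite -[_ *+ _]mulr_natr mulrC ltr_pdivlMr ?ltr0n//.
  by apply: lt_le_trans (truncnS_gt _) _; rewrite ler_nat.
have cS : countable (\bigcup_k \bigcup_j S k j).
  apply: bigcup_countable => // k _; apply: bigcup_countable => // j _.
  exact: finite_set_countable.
have sub : (`[0, 1]%classic : set R) `<=` \bigcup_k \bigcup_j S k j.
  move=> s /=; rewrite in_itv /= => s01; apply: contrapT => nS; apply: noz.
  exists s => //.
  have -> : A s = \bigcup_k (A s `&` F k) by rewrite -setI_bigcupr -TF setIT.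
  apply: measure_negligible; first exact: bigcupT_measurable.
  apply: negligible_bigcup => k; apply/negligibleP => //.
  apply/eqP; rewrite eq_le measure_ge0 andbT; apply/lee_addgt0Pr => e e0.
  rewrite add0e leNgt; apply/negP => eA; apply: nS; exists k => //.
  exists (Num.truncn e^-1) => //; rewrite /S /=; apply: le_trans (ltW eA).
  rewrite lee_fin invf_ple ?posrE ?ltr0n//; exact/ltW/truncnS_gt.
have : lebesgue_measure (`[0, 1]%classic : set R) = 0%E.
  by apply: countable_lebesgue_measure0; exact: sub_countable (subset_card_le sub) cS.
rewrite lebesgue_measure_itv /= lte_fin ltr01 oppr0 adde0 => /eqP.
by rewrite eqe oner_eq0.
Qed.

End uncountable_disjoint.

Section exit_set.
Context {R : realType} {n : nat}.
Local Notation V := 'rV[R]_n.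
Variables (F : V -> V) (phi : R -> V -> V) (X : set V).
Hypotheses (F_cont : continuous F) (F_flow : generates_flow F phi)
  (phi_nonsing : nonsingular_flow phi) (X_compact : compact X)
  (X_back : backward_invariant phi X).

Definition exit_set : set V := X `&` [set x | forall t, 0 < t -> ~ X (phi t x)].

Let cphi t : continuous (phi t). Proof. exact: flow_continuous F_cont F_flow t. Qed.

Let back s t x : s <= t -> X (phi t x) -> X (phi s x).
Proof.
rewrite le_eqVlt => /predU1P[->//|st Xt].
have -> : phi s x = phi (- (t - s)) (phi t x).
  by rewrite -(flowD F_flow) opprB subrK.
by apply: (X_back (t := t - s)); [rewrite subr_gt0|exists (phi t x)].
Qed.

Lemma exit_set_measurable : measurable exit_set.
Proof.
have mX := compact_measurable_rV X_compact.
have -> : exit_set = X `&` \bigcap_k (phi k.+1%:R^-1 @^-1` (~` X)).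
  apply/seteqP; split => x [Xx xP]; split => //.
    by move=> k _; apply: xP; rewrite invr_gt0.
  move=> t t0 Xt; apply: (xP (Num.truncn t^-1) Logic.I) => /=.
  apply: back Xt; rewrite invf_ple ?posrE ?ltr0n//; exact/ltW/truncnS_gt.
apply: measurableI => //; apply: bigcapT_measurable => k.
rewrite -[X in measurable X]setTI.
by apply: (continuous_measurable_rVrV (@cphi _)) => //; exact: measurableC.
Qed.

(* The images of the exit set under the flow are pairwise disjoint. *)
Lemma exit_set_null : lebesgue_rV n exit_set = 0%E.
Proof.
apply/eqP; apply: contraT => E0.
pose A s := phi (- s) @^-1` exit_set.
have mA s : measurable (A s).
  rewrite -[X in measurable X]setTI.
  apply: (continuous_measurable_rVrV (@cphi _)) => //.
  exact: exit_set_measurable.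
have disj s t : s < t -> A s `&` A t = set0.
  move=> st; apply/seteqP; split => // x [[Xs _] [_ Et]].
  apply: (Et (t - s)); first by rewrite subr_gt0.
  by rewrite -(flowD F_flow) addrAC subrr add0r.
have [||s /andP[s0 _] As0] := @uncountable_disjoint_null _ _ _ (lebesgue_rV n) A.
- exact: mA.
- move=> s t; rewrite neq_lt => /orP[|ts]; first exact: disj.
  by rewrite setIC; exact: disj.
move: s0; rewrite le_eqVlt => /predU1P[s0|s0].
  move/eqP: E0; rewrite -As0 /A -s0 oppr0 => E0; exfalso; apply: E0.
  by congr (_ _); apply/seteqP; split => x /=; rewrite (flow0 F_flow).
have := phi_nonsing exit_set_measurable s0 E0; rewrite -As0 => /eqP h.
exfalso; apply: h; congr (_ _); apply/seteqP; split => [x [y Ey <-]|x Ax].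
  by rewrite /A /= -(flowD F_flow) addNr (flow0 F_flow).
by exists (phi (- s) x) => //; rewrite -(flowD F_flow) subrr (flow0 F_flow).
Qed.

Lemma notin_exit_set x : X x -> ~ exit_set x ->
  \forall t \near 0^'+, X (phi t x).
Proof.
move=> Xx nE; have [t [t0 Xt]] : exists t, 0 < t /\ X (phi t x).
  apply: contrapT => h; apply: nE; split => // t t0 Xt.
  by apply: h; exists t.
near=> s; apply: back Xt.
near: s; exact: nbhs_right_le.
Unshelve. all: by end_near. Qed.

End exit_set.

(** * Independent samples *)

Lemma integral_prob_cst {R : realType} {d : measure_display}
    {T : measurableType d} (P : probability T R) (c : R) :
  (\int[P]_w c%:E = c%:E)%E.
Proof.
transitivity (c%:E * P setT)%E; first exact: integral_cst.
have -> : P setT = 1%E by exact: probability_setT.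
by rewrite mule1.
Qed.

Section product_law.
Context {R : realType} {d d1 d2 : measure_display} {Omega : measurableType d}
  {T1 : measurableType d1} {T2 : measurableType d2} (P : probability Omega R).

Definition independent_pair (Y : Omega -> T1) (Z : Omega -> T2) :=
  forall A B, measurable A -> measurable B ->
  P ((Y @^-1` A) `&` (Z @^-1` B)) = (P (Y @^-1` A) * P (Z @^-1` B))%E.

Variables (Y : {RV P >-> T1}) (Z : {RV P >-> T2}).
Hypothesis YZ : independent_pair Y Z.

Lemma measurable_pairRV :
  measurable_fun [set: Omega] (fun w => (Y w, Z w)).
Proof. exact: measurable_fun_pair. Qed.

Definition pairRV : {RV P >-> (T1 * T2)%type} :=
  mfun_Sub (mem_set measurable_pairRV).

Lemma pairRV_law C : measurable C ->
  P ((fun w => (Y w, Z w)) @^-1` C) =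
  (distribution P Y \x distribution P Z)%E C.
Proof.
move=> mC; rewrite (@product_measure_unique _ _ _ _ _ (distribution P Y)
  (distribution P Z) (distribution P pairRV))//.
Qed.

Lemma expectation_prod (f : T1 -> R) (g : T2 -> R) (Cf Cg : R) :
  measurable_fun [set: T1] f -> measurable_fun [set: T2] g ->
  (forall y, `|f y| <= Cf) -> (forall z, `|g z| <= Cg) ->
  (\int[P]_w (f (Y w) * g (Z w))%:E =
   \int[P]_w (f (Y w))%:E * \int[P]_w (g (Z w))%:E)%E.
Proof.
move=> mf mg fC gC.
have mfg : measurable_fun [set: T1 * T2] (fun yz => f yz.1 * g yz.2).
  by apply: measurable_funM; apply: measurableT_comp.
have bfg yz : `|f yz.1 * g yz.2| <= Cf * Cg by rewrite normrM ler_pM.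
have int_bnd d' (T : measurableType d') (mu : probability T R) (h : T -> R) C :
    measurable_fun [set: T] h -> (forall t, `|h t| <= C) ->
    mu.-integrable [set: T] (EFin \o h).
  move=> mh hC; apply: measurable_bounded_integrable => //.
    exact: (le_lt_trans (probability_le1 mu measurableT) (ltry _)).
  exists C; split; first exact: num_real.
  by move=> M CM t _; rewrite /= (le_trans (hC t))// ltW.
have h1 : (\int[P]_w (f (Y w) * g (Z w))%:E =
    \int[distribution P pairRV]_yz (f yz.1 * g yz.2)%:E)%E.
  rewrite integral_distribution//; first exact/measurable_EFinP.
  apply: (int_bnd _ _ _ (fun w => f (Y w) * g (Z w)) (Cf * Cg)).
    by apply: measurable_funM; apply: measurableT_comp.
  by move=> w; exact: (bfg (Y w, Z w)).
rewrite h1 (@eq_measure_integral _ _ _ _ (distribution P Y \x distribution P Z)%E); last first.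
  by move=> A mA _; exact: pairRV_law.
have ifg : (distribution P Y \x distribution P Z)%E.-integrable [set: T1 * T2]
    (fun yz => (f yz.1 * g yz.2)%:E).
  exact: (int_bnd _ _ (distribution P Y \x distribution P Z)%E
    (fun yz => f yz.1 * g yz.2) (Cf * Cg)).
rewrite -(integral12_prod_meas1 ifg) /fubini_F /=.
have ig : (distribution P Z).-integrable [set: T2] (EFin \o g).
  exact: (int_bnd _ _ (distribution P Z) g Cg).
have if_ : (distribution P Y).-integrable [set: T1] (EFin \o f).
  exact: (int_bnd _ _ (distribution P Y) f Cf).
have -> : (fun y => \int[distribution P Z]_z (f y * g z)%:E)%E =
    (fun y => (f y)%:E * \int[distribution P Z]_z (g z)%:E)%E.
  by apply/funext => y; under eq_integral do rewrite EFinM; rewrite integralZl.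
have Ig : (\int[distribution P Z]_z (g z)%:E = \int[P]_w (g (Z w))%:E)%E.
  rewrite integral_distribution//; first exact/measurable_EFinP.
  apply: (int_bnd _ _ P (g \o Z) Cg); first exact: measurableT_comp.
  by move=> w; exact: gC.
have If : (\int[distribution P Y]_y (f y)%:E = \int[P]_w (f (Y w))%:E)%E.
  rewrite integral_distribution//; first exact/measurable_EFinP.
  apply: (int_bnd _ _ P (f \o Y) Cf); first exact: measurableT_comp.
  by move=> w; exact: fC.
rewrite -Ig -If.
have Ifin : (\int[distribution P Z]_z (g z)%:E)%E \is a fin_num.
  exact: (integrable_fin_num measurableT ig).
rewrite -(fineK Ifin); under eq_integral do rewrite muleC.
by rewrite integralZl// muleC.
Qed.

End product_law.

Section sequences.
Context {R : realType}.

Lemma sqrt_bracket (K : nat) : exists m, (m ^ 2 <= K < m.+1 ^ 2)%N.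
Proof.
elim: K => [|K [m /andP[mK Km]]]; first by exists 0%N.
have [h|h] := ltnP K.+1 (m.+1 ^ 2); first by exists m; rewrite (leq_trans mK).
exists m.+1; rewrite h -ltnS /= ltnS.
by apply: leq_ltn_trans Km _; rewrite ltn_exp2r.
Qed.

Lemma cesaro_squares (y : nat -> R) (B : R) : (forall k, `|y k| <= B) ->
  (\sum_(k < m ^ 2) y k) / (m ^ 2)%:R @[m --> \oo] --> (0 : R) ->
  (\sum_(k < K) y k) / K%:R @[K --> \oo] --> (0 : R).
Proof.
move=> yB /cvgrPdist_le sq; have B0 : 0 <= B by exact: le_trans (yB 0%N).
apply/cvgrPdist_le => e e0; have e2 : 0 < e / 2 by rewrite divr_gt0.
have [M _ MP] := sq _ e2.
pose M1 := maxn (maxn M 1) (Num.truncn (6 * B / e)).+1.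
exists (M1 ^ 2)%N => // K /= MK; rewrite sub0r normrN.
have [m /andP[mK Km]] := sqrt_bracket K.
have M1m : (M1 <= m)%N.
  by rewrite -ltnS -(@ltn_exp2r _ _ 2)//; exact: leq_ltn_trans Km.
have Mm : (M <= m)%N.
  by apply: leq_trans M1m; rewrite /M1 (leq_trans (leq_maxl M 1))// leq_maxl.
have m1 : (0 < m)%N.
  by apply: leq_trans M1m; rewrite /M1 (leq_trans (leq_maxr M 1))// leq_maxl.
have mB : 6 * B <= e * m%:R.
  rewrite [leRHS]mulrC -ler_pdivrMr//; apply: ltW; apply: (lt_le_trans (truncnS_gt _)).
  by rewrite ler_nat (leq_trans _ M1m)// leq_maxr.
have := MP m Mm; rewrite /= sub0r normrN => sm.
have m2 : 0 < (m ^ 2)%:R :> R by rewrite ltr0n expn_gt0 m1.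
have K0 : 0 < K%:R :> R by rewrite ltr0n (leq_trans _ mK)// expn_gt0 m1.
rewrite normrM normfV (gtr0_norm K0) ler_pdivrMr//.
rewrite normrM normfV (gtr0_norm m2) ler_pdivrMr// in sm.
have split : `|\sum_(k < K) y k| <= `|\sum_(k < m ^ 2) y k| + B * (K - m ^ 2)%:R.
  rewrite -!(big_mkord xpredT) (big_cat_nat _ (n := m ^ 2))//=.
  rewrite (le_trans (ler_normD _ _))// lerD2l (le_trans (ler_norm_sum _ _ _))//.
  rewrite mulr_natr -sumr_const_nat; exact: ler_sum.
apply: (le_trans split).
have : (K - m ^ 2 <= 3 * m)%N.
  rewrite leq_subLR -ltnS; apply: leq_trans Km _.
  by rewrite !expnS !expn0; nia.
rewrite -(ler_nat R) natrM => h1.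
have h2 : (m ^ 2)%:R <= K%:R :> R by rewrite ler_nat.
have h3 : (m ^ 2)%:R = m%:R * m%:R :> R by rewrite natrX expr2.
have m0 : 0 < m%:R :> R by rewrite ltr0n.
have h4 : B * (K - m ^ 2)%:R <= B * (3 * m%:R) by rewrite ler_wpM2l.
have h5 : 6 * B * m%:R <= e * m%:R * m%:R by rewrite ler_wpM2r// ltW.
have h6 : e * (m ^ 2)%:R <= e * K%:R by rewrite ler_wpM2l// ltW.
rewrite h3 in sm h6; clear -split h4 h5 h6 sm h1 B0 m0 e0.
have h7 : B * (3 * m%:R) <= e / 2 * (m%:R * m%:R) by nra.
by apply: le_trans (lerD sm (le_trans h4 h7)) _; lra.
Qed.

Lemma sum_inv_squares (n : nat) :
  \sum_(0 <= k < n) (k.+1%:R ^+ 2)^-1 <= 2 :> R.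
Proof.
suff h m : \sum_(0 <= k < m.+1) (k.+1%:R ^+ 2)^-1 <= 2 - m.+1%:R^-1 :> R.
  case: n => [|m]; first by rewrite big_geq.
  by rewrite (le_trans (h m))// gerBl invr_ge0.
elim: m => [|m IH].
  by rewrite big_nat1 expr1n invr1; lra.
rewrite big_nat_recr//= (le_trans (lerD IH (lexx _)))//.
have m0 : 0 < m.+1%:R :> R by rewrite ltr0n.
have -> : m.+2%:R = m.+1%:R + 1 :> R by rewrite natr1.
move: (m.+1%:R) m0 => t t0.
have t1 : 0 < t + 1 by lra.
rewrite -subr_ge0.
have -> : 2 - (t + 1)^-1 - (2 - t^-1 + ((t + 1) ^+ 2)^-1) =
    (t * (t + 1) ^+ 2)^-1 :> R.
  by field; rewrite !gt_eqF.
by rewrite invr_ge0 mulr_ge0 ?exprn_ge0// ltW.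
Qed.

End sequences.

Section law_of_large_numbers.
Context {R : realType} {d d' : measure_display} {Omega : measurableType d}
  {T : measurableType d'} (P : probability Omega R).
Variable x : nat -> {RV P >-> T}.
Hypothesis x_indep : mutually_independent P x.

Lemma independent_seq (s : seq nat) (A : nat -> set T) : uniq s ->
  (forall k, measurable (A k)) ->
  P (\bigcap_(k in [set` s]) (x k @^-1` A k)) =
  (\prod_(k <- s) P (x k @^-1` A k))%E.
Proof.
move=> us mA; have := x_indep [fset k in s]%fset mA.
have -> : [set` [fset k in s]%fset] = [set` s].
  by apply/seteqP; split => k /=; rewrite inE.
move=> ->; apply: perm_big.
by apply: uniq_perm; [exact: fset_uniq|exact: us|move=> k; rewrite inE].
Qed.

Lemma independent_pairRV i j : i != j -> independent_pair P (x i) (x j).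
Proof.
move=> ij A B mA mB.
have us : uniq [:: i; j] by rewrite /= inE ij.
have ji : j == i = false by rewrite eq_sym (negbTE ij).
have := @independent_seq [:: i; j] (fun k => if k == i then A else B) us.
rewrite !big_cons big_nil eqxx ji mule1 => <-; last by move=> k; case: ifP.
congr (P _); apply/seteqP; split => w /=.
  by move=> [wA wB] k /=; rewrite !inE => /orP[]/eqP->; rewrite ?eqxx ?ji.
move=> h; split.
  by have := h i; rewrite /= eqxx; apply; rewrite inE eqxx.
by have := h j; rewrite /= ji; apply; rewrite !inE eqxx orbT.
Qed.

Lemma bounded_integrable (f : Omega -> R) (C : R) :
  measurable_fun [set: Omega] f -> (forall w, `|f w| <= C) ->
  P.-integrable [set: Omega] (EFin \o f).
Proof.
move=> mf fC; apply: measurable_bounded_integrable => //.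
  exact: (le_lt_trans (probability_le1 P measurableT) (ltry _)).
exists C; split; first exact: num_real.
by move=> M CM t _; rewrite /= (le_trans (fC t))// ltW.
Qed.

Variables (g : T -> R) (C : R).
Hypotheses (mg : measurable_fun [set: T] g) (gC : forall t, `|g t| <= C)
  (g0 : forall k, (\int[P]_w (g (x k w))%:E = 0)%E).

Let S K w := \sum_(k < K) g (x k w).

Let mgx k : measurable_fun [set: Omega] (fun w => g (x k w)).
Proof. exact: measurableT_comp. Qed.

Let mS K : measurable_fun [set: Omega] (S K).
Proof. by apply: measurable_sum => k; exact: mgx. Qed.

Lemma variance_sum_le K : (\int[P]_w (S K w ^+ 2)%:E <= (K%:R * C ^+ 2)%:E)%E.
Proof.
have C0 : 0 <= C by exact: le_trans (gC point).
have int2 i j : P.-integrable [set: Omega]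
    (EFin \o (fun w => g (x i w) * g (x j w))).
  apply: (@bounded_integrable _ (C * C)); first exact: measurable_funM.
  by move=> w; rewrite normrM ler_pM.
have -> : (fun w => (S K w ^+ 2)%:E) = (fun w =>
    \sum_(i < K) \sum_(j < K) (g (x i w) * g (x j w))%:E)%E.
  apply/funext => w; rewrite expr2 /S mulr_suml -sumEFin.
  by apply: eq_bigr => i _; rewrite mulr_sumr sumEFin.
rewrite integral_sum//; last first.
  by move=> i; apply: integrable_sum => // j _; exact: int2.
have h (i : 'I_K) : (\int[P]_w (\sum_(j < K) (g (x i w) * g (x j w))%:E) <= (C ^+ 2)%:E)%E.
  rewrite integral_sum//; last by move=> j; exact: int2.
  rewrite (bigD1 i)//= [X in (_ + X)%E]big1; last first.
    move=> j ji; rewrite (expectation_prod _ mg mg gC gC) ?g0 ?mule0//.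
    by apply: independent_pairRV; rewrite eq_sym.
  rewrite adde0; apply: (@le_trans _ _ (\int[P]_w (C ^+ 2)%:E)%E).
    apply: ge0_le_integral => //.
    - by move=> w _; rewrite lee_fin -expr2 sqr_ge0.
    - by apply/measurable_EFinP; exact: measurable_funM.
    - move=> w _; rewrite lee_fin -expr2 -[leLHS]ger0_norm ?sqr_ge0//.
      by rewrite normrX lerXn2r ?nnegrE.
  by rewrite integral_prob_cst.
apply: le_trans (lee_sum _ (fun i _ => h i)) _.
by rewrite sumEFin sumr_const card_ord mulr_natl.
Qed.

(* The variances of the means along the squares are summable. *)
Lemma centered_lln : {ae P, forall w, S K w / K%:R @[K --> \oo] --> (0 : R)}.
Proof.
pose W m w := (S (m.+1 ^ 2) w / (m.+1 ^ 2)%:R) ^+ 2.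
have W0 m w : (0 <= (W m w)%:E)%E by rewrite lee_fin sqr_ge0.
have mW m : measurable_fun [set: Omega] (fun w => (W m w)%:E).
  apply/measurable_EFinP; apply: measurable_funX; exact: measurable_funM.
have IW m : (\int[P]_w (W m w)%:E <= (C ^+ 2 * (m.+1%:R ^+ 2)^-1)%:E)%E.
  have k0 : 0 < (m.+1 ^ 2)%:R :> R by rewrite ltr0n expn_gt0.
  have -> : (fun w => (W m w)%:E) = (fun w =>
      (((m.+1 ^ 2)%:R ^+ 2)^-1)%:E * (S (m.+1 ^ 2) w ^+ 2)%:E)%E.
    by apply/funext => w; rewrite -EFinM /W expr_div_n mulrC.
  have c0 : (0 <= (((m.+1 ^ 2)%:R ^+ 2)^-1)%:E :> \bar R)%E.
    by rewrite lee_fin invr_ge0 exprn_ge0.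
  have s0 w : [set: Omega] w -> (0 <= (S (m.+1 ^ 2) w ^+ 2)%:E)%E.
    by rewrite lee_fin sqr_ge0.
  have mS2 : measurable_fun [set: Omega] (fun w => (S (m.+1 ^ 2) w ^+ 2)%:E).
    by apply/measurable_EFinP; apply: measurable_funX; exact: mS.
  rewrite (ge0_integralZl P measurableT mS2 s0)//.
  apply: le_trans (lee_wpmul2l _ (variance_sum_le _)) _.
    by rewrite lee_fin invr_ge0 exprn_ge0.
  rewrite -EFinM lee_fin natrX le_eqVlt; apply/orP; left; apply/eqP.
  by field; rewrite nat1r pnatr_eq0.
have fin : (\int[P]_w (\sum_(0 <= m <oo) (W m w)%:E) < +oo)%E.
  rewrite integral_nneseries//.
  apply: (@le_lt_trans _ _ (C ^+ 2 * 2)%:E); last exact: ltry.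
  apply: lime_le.
    by apply: is_cvg_nneseries => m _ _; apply: integral_ge0 => w _.
  apply: nearW => k; apply: le_trans (lee_sum _ (fun m _ => IW m)) _.
  rewrite sumEFin lee_fin -mulr_sumr ler_wpM2l ?sqr_ge0//.
  exact: sum_inv_squares.
have int : P.-integrable [set: Omega] (fun w => \sum_(0 <= m <oo) (W m w)%:E)%E.
  have s0 w : (0 <= \sum_(0 <= m <oo) (W m w)%:E)%E by apply: nneseries_ge0.
  apply/integrableP; split; first by apply: ge0_emeasurable_sum => // m _.
  by under eq_integral do rewrite gee0_abs//.
have := integrable_ae measurableT int; apply: filterS => w /(_ Logic.I) fw.
have sq : S (m ^ 2) w / (m ^ 2)%:R @[m --> \oo] --> (0 : R).
  rewrite -(cvg_shiftS (fun m => S (m ^ 2) w / (m ^ 2)%:R)).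
  suff w2 : W m w @[m --> \oo] --> (0 : R).
    apply/norm_cvg0P.
    have : Num.sqrt (W m w) @[m --> \oo] --> Num.sqrt (0 : R).
      by apply: continuous_cvg w2; exact: sqrt_continuous.
    by rewrite sqrtr0; under eq_fun do rewrite sqrtr_sqr.
  apply/cvg_series_cvg_0/nnseries_is_cvg => [m|]; first exact: sqr_ge0.
  by move: fw; rewrite fin_numE => /andP[_]; rewrite -ltey.
by apply: (@cesaro_squares _ (fun k => g (x k w)) C).
Qed.

End law_of_large_numbers.

Section strong_lln.
Context {R : realType} {d d' : measure_display} {Omega : measurableType d}
  {T : measurableType d'} (P : probability Omega R).
Variable x : nat -> {RV P >-> T}.
Hypothesis x_indep : mutually_independent P x.

Lemma strong_lln (h : T -> R) (C m : R) : measurable_fun [set: T] h ->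
  (forall t, `|h t| <= C) ->
  (forall k, (\int[P]_w (h (x k w))%:E = m%:E)%E) ->
  {ae P, forall w, (\sum_(k < K) h (x k w)) / K%:R @[K --> \oo] --> m}.
Proof.
move=> mh hC hm.
have ih k : P.-integrable [set: Omega] (EFin \o (fun w => h (x k w))).
  apply: (@bounded_integrable _ _ _ _ _ C) => //.
  exact: measurableT_comp.
have mg : measurable_fun [set: T] (fun t => h t - m).
  exact: measurable_funB.
have gC t : `|h t - m| <= C + `|m|.
  by rewrite (le_trans (ler_normB _ _))// lerD2r.
have g0 k : (\int[P]_w (h (x k w) - m)%:E = 0)%E.
  under eq_integral do rewrite EFinB.
  rewrite integralB//.
    rewrite hm (_ : (\int[P]_w m%:E)%E = m%:E) ?subee//.
    exact: integral_prob_cst.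
    exact: ih.
  by apply: (@bounded_integrable _ _ _ P (cst m) `|m|).
apply: filterS (centered_lln x_indep mg gC g0) => w cw.
have : (\sum_(k < K) (h (x k w) - m)) / K%:R + m @[K --> \oo] --> 0 + m.
  by apply: cvgD => //; exact: cvg_cst.
rewrite add0r; apply: cvg_trans; apply: near_eq_cvg.
exists 1%N => // K /= K1; rewrite sumrB sumr_const card_ord mulrBl.
by rewrite -[m *+ K]mulr_natr mulfK ?subrK// pnatr_eq0 -lt0n.
Qed.

End strong_lln.

Section generic_rank.
Context {R : realType} {d d' : measure_display} {Omega : measurableType d}
  {T : measurableType d'} (P : probability Omega R).
Variables (x : nat -> {RV P >-> T}) (p : nat -> T -> R).
Hypotheses (x_indep : mutually_independent P x)
  (mp : forall i, measurable_fun [set: T] (p i))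
  (p_null : forall r (c : 'I_r.+1 -> R) k, c ord_max != 0 ->
    distribution P (x k) [set z | \sum_(i < r.+1) c i * p i z = 0] = 0%E).

(* [past r] is [Omega] with the sigma-algebra generated by the first [r] samples. *)
Definition past_cylinders r : set (set Omega) :=
  [set B | exists2 A : nat -> set T, (forall k, measurable (A k)) &
    B = \bigcap_(k in [set` iota 0 r]) (x k @^-1` A k)].

Definition past r := g_sigma_algebraType (past_cylinders r).

Lemma measurable_preimage k (A : set T) :
  measurable A -> measurable (x k @^-1` A).
Proof. by move=> mA; rewrite -[X in measurable X]setTI; exact: measurable_funPT. Qed.

Lemma past_cylinders_measurable r : past_cylinders r `<=` measurable.
Proof.
move=> _ [A mA ->]; rewrite bigcap_seq; apply: bigsetI_measurable => k _.
exact: measurable_preimage.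
Qed.

Lemma measurable_past r : measurable_fun [set: Omega] (idfun : Omega -> past r).
Proof.
move=> _ B mB; rewrite setTI.
suff : <<s past_cylinders r >> `<=` measurable by move=> /(_ B mB).
apply: smallest_sub; first exact: sigma_algebra_measurable.
exact: past_cylinders_measurable.
Qed.

Definition pastRV r : {RV P >-> past r} := mfun_Sub (mem_set (@measurable_past r)).

Lemma measurable_past_coord r k : (k < r)%N ->
  measurable_fun [set: past r] (x k : past r -> T).
Proof.
move=> kr _ A mA; rewrite setTI; apply: sub_sigma_algebra.
exists (fun i => if i == k then A else setT); first by move=> i; case: ifP.
apply/seteqP; split => w /=.
  by move=> wA i _ /=; case: eqP => // ->.
by move=> /(_ k); rewrite /= eqxx mem_iota; apply.
Qed.

Lemma independent_past r : independent_pair P (pastRV r) (x r).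
Proof.
move=> A B mA mB; move: A mA.
have xE k (D : set T) : measurable D -> measurable (x k @^-1` D).
  exact: measurable_preimage.
apply: (@dynkin_induction _ (past r) (past_cylinders r)
  (fun A => P (pastRV r @^-1` A `&` x r @^-1` B) =
            (P (pastRV r @^-1` A) * P (x r @^-1` B))%E)) => //=.
- move=> _ _ [A mA ->] [A' mA' ->].
  exists (fun k => A k `&` A' k); first by move=> k; exact: measurableI.
  apply/seteqP; split => w /=.
    by move=> [h h'] k kr; split; [exact: h|exact: h'].
  by move=> h; split => k kr; have [] := h k kr.
- by rewrite preimage_setT setTI probability_setT mul1e.
- move=> _ [A mA ->].
  pose A' k := if k == r then B else A k.
  have mA' k : measurable (A' k) by rewrite /A'; case: ifP.
  have u1 : uniq (iota 0 r) by exact: iota_uniq.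
  have u2 : uniq (iota 0 r.+1) by exact: iota_uniq.
  have := independent_seq x_indep u2 mA'.
  have A'r : A' r = B by rewrite /A' eqxx.
  rewrite -addn1 iotaD add0n big_cat big_seq1 A'r.
  have -> : (\prod_(k <- iota 0 r) P (x k @^-1` A' k) =
      \prod_(k <- iota 0 r) P (x k @^-1` A k))%E.
    apply: eq_big_seq => k; rewrite mem_iota add0n => /andP[_ kr].
    by rewrite /A' ltn_eqF.
  rewrite -(independent_seq x_indep u1 mA) => <-.
  congr (P _); apply/seteqP; split => w /=.
    move=> [h wB] k; rewrite /= mem_cat inE /A' => /orP[kr|/eqP->].
      case: eqP => [->//|_]; exact: h.
    by rewrite eqxx.
  move=> h; split.
    move=> k kr; have := h k; rewrite /= mem_cat /A'.
    move: (kr); rewrite /= mem_iota add0n => /andP[_ kr'].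
    by rewrite ltn_eqF//; apply; rewrite kr'.
  by have := h r; rewrite /= mem_cat /A' eqxx inE eqxx orbT; exact.
- move=> S mS h.
  have mS' : measurable (pastRV r @^-1` S).
    by rewrite -[X in measurable X]setTI; exact: measurable_past.
  have mC := xE r B mB; set C := x r @^-1` B in mC h *.
  have fin (D : set Omega) : measurable D -> P D = (fine (P D))%:E.
    by move=> mD; rewrite fineK//; exact: fin_num_measure.
  pose D : set Omega := S; have hD : P (D `&` C) = (P D * P C)%E by exact: h.
  change (P (~` D `&` C) = (P (~` D) * P C)%E).
  rewrite probability_setC// setIC -setDE measureD//; last first.
    exact: (le_lt_trans (probability_le1 P mC) (ltry _)).
  have -> : (P C - P (C `&` D) = P C - P D * P C)%E.
    by congr (_ - _)%E; rewrite setIC; exact: hD.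
  have [c cE] : exists c, P C = c%:E by exists (fine (P C)); exact: fin.
  have [s sE] : exists s, P D = s%:E by exists (fine (P D)); exact: fin.
  have aux : (c%:E - s%:E * c%:E = (1 - s%:E) * c%:E :> \bar R)%E.
    by rewrite -EFinM -!EFinB -EFinM; congr (_%:E); ring.
  by move: aux; rewrite -cE -sE.
- move=> F mF tF h.
  have mF' k : measurable (pastRV r @^-1` F k).
    by rewrite -[X in measurable X]setTI; exact: measurable_past.
  have tF' : trivIset setT (fun k => pastRV r @^-1` F k) by [].
  have mC := xE r B mB; set C := x r @^-1` B in mC h *.
  rewrite preimage_bigcup setI_bigcupl measure_semi_bigcup//; last 3 first.
  + by move=> k; exact: measurableI.
  + by apply: trivIset_setIr.
  + by apply: bigcupT_measurable => k; exact: measurableI.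
  rewrite measure_semi_bigcup//; last exact: bigcupT_measurable.
  have [c cE] : exists c, P C = c%:E.
    exists (fine (P C)); rewrite fineK//; exact: fin_num_measure.
  have hk k : P (pastRV r @^-1` F k `&` C) = (c%:E * P (pastRV r @^-1` F k))%E.
    by rewrite muleC -cE; exact: h.
  rewrite (_ : P _ = c%:E); last exact: cE.
  rewrite (eq_eseriesr (fun k _ => hk k)) nneseriesZl//.
  exact: muleC.
Qed.

Let sample_mx r w : 'M[R]_r := \matrix_(k < r, i < r) p i (x k w).

Let coef r (w : past r) (i : 'I_r.+1) : R :=
  cofactor (sample_mx r.+1 w) ord_max i.

Let mcoef r i : measurable_fun [set: past r] (fun w => coef w i).
Proof.
rewrite /coef /cofactor /determinant.
apply: measurable_funM => //; apply: measurable_sum => s.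
apply: measurable_funM => //; apply: measurable_prod => k _.
under eq_fun do rewrite !mxE lift_max.
apply: (measurableT_comp (mp _)); exact: measurable_past_coord.
Qed.

(* Expanding along the last row, the minor of order [r.+1] vanishes only if
   sample [r] is a zero of a combination of [p 0 .. p r] whose coefficients
   depend on the past only and whose last one is the minor of order [r]. *)
Lemma generic_rank r :
  {ae P, forall w, \det (\matrix_(k < r, i < r) p i (x k w)) != 0}.
Proof.
elim: r => [|r IH]; first by apply: aeW => w; rewrite det_mx00 oner_neq0.
pose S : set (past r * T) := [set wz | coef wz.1 ord_max != 0 /\
  \sum_(i < r.+1) coef wz.1 i * p i wz.2 = 0].
have mc i : measurable_fun [set: past r * T] (fun wz => coef wz.1 i).
  exact: (measurableT_comp (@mcoef r i) measurable_fst).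
have mS : measurable S.
  rewrite (_ : S = ((fun wz => coef wz.1 ord_max) @^-1` (~` [set 0])) `&`
      ((fun wz => \sum_(i < r.+1) coef wz.1 i * p i wz.2) @^-1` [set 0])).
    apply: measurableI.
      by rewrite -[X in measurable X]setTI; apply: (mc ord_max) => //;
        exact: measurableC.
    rewrite -[X in measurable X]setTI.
    suff mm : measurable_fun [set: past r * T]
        (fun wz => \sum_(i < r.+1) coef wz.1 i * p i wz.2) by exact: mm.
    apply: measurable_sum => i; apply: measurable_funM => //.
    by apply: measurableT_comp.
  by apply/seteqP; split => -[w z] /= [/eqP].
have S0 : P ((fun w => (pastRV r w, x r w)) @^-1` S) = 0%E.
  rewrite (pairRV_law (@independent_past r) mS).
  transitivity (\int[distribution P (pastRV r)]_w (cst 0%E w : \bar R))%E.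
    apply: eq_integral => w _ /=.
    have [c0|c0] := eqVneq (coef w ord_max) 0.
      rewrite (_ : xsection _ _ = set0) ?measure0//.
      by apply/seteqP; split => z; rewrite /xsection /= inE // => -[]; rewrite c0 eqxx.
    rewrite (_ : xsection _ _ = [set z | \sum_(i < r.+1) coef w i * p i z = 0]).
      exact: p_null.
    apply/seteqP; split => z; rewrite /xsection /= inE; first by case.
    by move=> h; split.
  exact: integral0.
have mS' : measurable ((fun w => (pastRV r w, x r w)) @^-1` S).
  rewrite -[X in measurable X]setTI; apply: (measurable_pairRV (pastRV r) (x r)) => //.
have nS : {ae P, forall w, ~ S (pastRV r w, x r w)}.
  exists ((fun w => (pastRV r w, x r w)) @^-1` S); split => // w /=.
  by move=> /contrapT.
have cE (w : past r) : coef w ord_max = \det (sample_mx r w).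
  rewrite /coef /cofactor /= addnn -signr_odd odd_double mul1r; apply: (congr1 determinant).
  by apply/matrixP => k i; rewrite !mxE !lift_max.
apply: filterS2 IH nS => w Dr nSw; apply/eqP => D0; apply: nSw; split.
  by rewrite /= cE.
rewrite -[RHS]D0 (expand_det_row _ ord_max); apply: eq_bigr => i _.
by rewrite mulrC mxE.
Qed.

End generic_rank.

(** * Lifting limits *)

(* [pinv] is qualified since MathComp-Analysis has a [pinv] of functions. *)
Section pseudoinverse.
Context {R : realType} {K N : nat}.
Implicit Types A : 'M[R]_(K, N).

Lemma gram_unitmx A : (forall v : 'cV[R]_N, A *m v = 0 -> v = 0) ->
  A^T *m A \in unitmx.
Proof.
move=> Ainj; rewrite -unitmx_tr -row_free_unit; apply/row_freeP.
have/row_freeP[B] : row_free (A^T *m A)^T; last by move=> BE; exists B.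
apply/inj_row_free => u uA.
have v0 : A *m u^T = 0.
  have : (A *m u^T)^T *m (A *m u^T) = 0.
    rewrite trmx_mul trmxK mulmxA -(mulmxA u).
    by move: uA; rewrite trmx_mul trmxK => ->; rewrite mul0mx.
  move: (A *m u^T) => y yy; apply/matrixP => i j; rewrite ord1 mxE.
  have : (y^T *m y) 0 0 = 0 by rewrite yy mxE.
  rewrite mxE => /eqP; rewrite psumr_eq0; last first.
    by move=> k _; rewrite mxE -expr2 sqr_ge0.
  move=> /allP/(_ i); rewrite mem_index_enum => /(_ isT).
  by rewrite mxE -expr2 sqrf_eq0 => /eqP.
by have := Ainj _ v0; move/(congr1 trmx); rewrite trmxK trmx0.
Qed.

Lemma pinv_full_rank A : A^T *m A \in unitmx ->
  Defs.pinv A = invmx (A^T *m A) *m A^T.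
Proof.
move=> uA; set B := invmx (A^T *m A) *m A^T.
have BA : B *m A = 1%:M by rewrite /B -mulmxA mulVmx.
have pB : is_pinv A B.
  split; first by rewrite -mulmxA BA mulmx1.
  - by rewrite BA mul1mx.
  - by rewrite /B !trmx_mul trmxK trmx_inv trmx_mul trmxK mulmxA.
  - by rewrite BA trmx1.
rewrite /Defs.pinv; case: xgetP => [C _ [ACA CAC ACT CAT]|/(_ B)//].
have CA : C *m A = 1%:M.
  by rewrite -[LHS]mul1mx -BA -mulmxA (mulmxA A) ACA.
have AE : A^T = A^T *m (A *m C) by rewrite -ACT -trmx_mul ACA.
have -> : B = invmx (A^T *m A) *m (A^T *m (A *m C)) by rewrite -AE.
by rewrite (mulmxA A^T) mulKmx.
Qed.

Lemma pinv_mulmx_full_rank A : A^T *m A \in unitmx -> Defs.pinv A *m A = 1%:M.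
Proof. by move=> uA; rewrite pinv_full_rank// -mulmxA mulVmx. Qed.

End pseudoinverse.

Section logarithm_limit.
Context {R : realType} {N : nat}.

Lemma mxlog_limit (M : R -> 'M[R]_N) (D : 'M[R]_N) :
  T^-1 *: (M T - 1) @[T --> 0^'+] --> D ->
  (\forall T \near 0^'+, has_principal_log (M T)) /\
  T^-1 *: mxlog (M T) @[T --> 0^'+] --> D.
Proof.
move=> MD; have [r r0 logP] := @mxlog_near1 R N.
have T0 : T @[T --> (0 : R)^'+] --> (0 : R).
  by apply: cvg_within_filter; exact: cvg_id.
have DB : \forall T \near (0 : R)^'+, `|T^-1 *: (M T - 1)| <= `|D| + 1.
  have /cvgrPdist_le/(_ 1 ltr01) := MD; apply: filterS => T h.
  have := ler_normB D (D - T^-1 *: (M T - 1)).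
  by rewrite subKr => /le_trans; apply; rewrite lerD2l.
set B := `|D| + 1 in DB; have B0 : 0 < B by rewrite ltr_wpDl.
have MB : \forall T \near (0 : R)^'+, 0 < T /\ `|M T - 1| <= B * T.
  near=> T; have t0 : 0 < T by near: T; exact: nbhs_right_gt.
  split => //; rewrite -(ler_pM2l (_ : 0 < T^-1)) ?invr_gt0//.
  rewrite mulrCA mulVf ?mulr1 ?gt_eqF//.
  rewrite -[T^-1 in leLHS]gtr0_norm ?invr_gt0// -normrZ.
  by near: T.
have Mr : \forall T \near (0 : R)^'+, 0 < T /\ `|M T - 1| <= B * T /\ `|M T - 1| <= r.
  near=> T; have [t0 Tr] : 0 < T /\ `|M T - 1| <= B * T by near: T.
  do 2!split => //; apply: le_trans Tr _; rewrite mulrC -ler_pdivlMr//.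
  by near: T; apply: nbhs_right_le; rewrite divr_gt0.
split; first by apply: filterS Mr => T [_ [_ /logP[]]].
pose C := 8 * N%:R ^+ 2 * B ^+ 2 : R.
have C0 : 0 <= C by rewrite !mulr_ge0 ?exprn_ge0// ltW.
have err : T^-1 *: (mxlog (M T) - (M T - 1)) @[T --> 0^'+] --> (0 : 'M[R]_N).
  apply/cvgr0Pnorm_le => e e0.
  have eC : 0 < e / (C + 1).
    by rewrite divr_gt0// ltr_wpDl.
  near=> T; have [t0 [TB Tr]] : 0 < T /\ `|M T - 1| <= B * T /\ `|M T - 1| <= r.
    by near: T.
  have [_ h] := logP _ Tr.
  rewrite normrZ gtr0_norm ?invr_gt0// mulrC ler_pdivrMr//.
  apply: le_trans h _; apply: (@le_trans _ _ (8 * N%:R ^+ 2 * (B * T) ^+ 2)).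
    rewrite ler_wpM2l ?mulr_ge0 ?exprn_ge0// lerXn2r ?nnegrE//.
    by rewrite mulr_ge0// ltW.
  have -> : 8 * N%:R ^+ 2 * (B * T) ^+ 2 = C * T * T by rewrite /C; ring.
  rewrite ler_wpM2r ?ltW//.
  have Te : T < e / (C + 1) by near: T; exact: nbhs_right_lt.
  move: Te; rewrite ltr_pdivlMr ?ltr_wpDl// => Te; nra.
have -> : (fun T => T^-1 *: mxlog (M T)) =
    (fun T => T^-1 *: (mxlog (M T) - (M T - 1)) + T^-1 *: (M T - 1)).
  by apply/funext => T; rewrite -scalerDr subrK.
by rewrite -[D]add0r; exact: cvgD.
Unshelve. all: by end_near. Qed.

End logarithm_limit.

Section L2_space.
Context {R : realType} {n : nat}.
Local Notation V := 'rV[R]_n.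
Local Notation mu := (lebesgue_rV n).
Variable X : set V.
Hypothesis cX : compact X.
Implicit Types f g h : V -> R.

Lemma compact_bounded_fun f : continuous f ->
  exists2 C, 0 <= C & forall z, X z -> `|f z| <= C.
Proof.
move=> cf; have /compact_bounded[M [_ MP]] : compact (f @` X).
  by apply: continuous_compact => //; exact: continuous_subspaceT.
exists (`|M| + 1) => [|z Xz]; first by rewrite addr_ge0.
apply: (MP (`|M| + 1)); last by exists z.
by rewrite ltr_pwDr// ler_norm.
Qed.

Lemma continuous_integrable f : continuous f -> mu.-integrable X (EFin \o f).
Proof.
move=> cf; apply: measurable_bounded_integrable.
- exact: compact_measurable_rV.
- exact: compact_lebesgue_fin.
- by apply: measurable_funS (continuous_measurable_rV cf).
- have [C C0 fC] := compact_bounded_fun cf.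
  exists C; split; first exact: num_real.
  by move=> M CM t Xt; rewrite /= (le_trans (fC t Xt))// ltW.
Qed.

Definition ip f g : R := \int[mu]_(z in X) (f z * g z).

Lemma continuous_funM f g : continuous f -> continuous g ->
  continuous (fun z => f z * g z).
Proof. by move=> cf cg z; exact: (cvgM (cf z) (cg z)). Qed.

Lemma ipC f g : ip f g = ip g f.
Proof. by apply: eq_Rintegral => z _; rewrite mulrC. Qed.

Lemma ip_ge0 f : 0 <= ip f f.
Proof. by apply: Rintegral_ge0 => z _; rewrite -expr2 sqr_ge0. Qed.

Lemma ipDl f g h : continuous f -> continuous g -> continuous h ->
  ip (fun z => f z + g z) h = ip f h + ip g h.
Proof.
move=> cf cg ch; rewrite /ip -RintegralD.
- by apply: eq_Rintegral => z _; rewrite mulrDl.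
- exact: compact_measurable_rV.
- by apply: continuous_integrable; exact: continuous_funM.
- by apply: continuous_integrable; exact: continuous_funM.
Qed.

Lemma continuous_funB f g : continuous f -> continuous g ->
  continuous (fun z => f z - g z).
Proof. by move=> cf cg z; exact: (cvgB (cf z) (cg z)). Qed.

Lemma ipBl f g h : continuous f -> continuous g -> continuous h ->
  ip (fun z => f z - g z) h = ip f h - ip g h.
Proof.
move=> cf cg ch; have cfg := continuous_funB cf cg.
apply/eqP; rewrite -subr_eq opprK -ipDl//; apply/eqP.
by apply: eq_Rintegral => z _; rewrite subrK.
Qed.

Lemma ipZl (a : R) f g : continuous f -> continuous g ->
  ip (fun z => a * f z) g = a * ip f g.
Proof.
move=> cf cg; rewrite /ip -RintegralZl.
- by apply: eq_Rintegral => z _; rewrite mulrA.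
- exact: compact_measurable_rV.
- by apply: continuous_integrable; exact: continuous_funM.
Qed.

Lemma ip_suml (I : Type) (r : seq I) (c : I -> R) (p : I -> V -> R) g :
  (forall i, continuous (p i)) -> continuous g ->
  ip (fun z => \sum_(i <- r) c i * p i z) g = \sum_(i <- r) c i * ip (p i) g.
Proof.
move=> cp cg; elim: r => [|i r IH].
  rewrite big_nil; under [ip _ _]eq_Rintegral do rewrite big_nil mul0r.
  rewrite /ip /Rintegral; rewrite (_ : integral _ _ _ = 0%E)//.
  by apply: integral0_eq.
rewrite big_cons -IH -ipZl// -ipDl//.
- by apply: eq_Rintegral => z _; rewrite big_cons.
- by apply: (@continuous_funM (cst (c i))) => // z; exact: cst_continuous.
- exact: continuous_lincomb.
Qed.

Lemma L2normE f : continuous f -> L2norm X f = (Num.sqrt (ip f f))%:E.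
Proof.
move=> cf; rewrite /L2norm Lnorm.unlock.
have -> : (\int[mu]_z (`|(EFin \o f \_ X) z| `^ 2) = (ip f f)%:E)%E.
  rewrite /ip /Rintegral fineK; last first.
    apply: integrable_fin_num; first exact: compact_measurable_rV.
    by apply: continuous_integrable; exact: continuous_funM.
  rewrite [RHS]integral_mkcond; apply: eq_integral => z _.
  rewrite /patch /=; case: ifP => _.
    by rewrite powR_mulrn// -normrX ger0_norm ?sqr_ge0// expr2.
  by rewrite normr0 powR0.
by rewrite poweR_EFin powR12_sqrt// ip_ge0.
Qed.

Lemma eq_L2norm f g : (forall z, X z -> f z = g z) -> L2norm X f = L2norm X g.
Proof.
move=> fg; rewrite /L2norm; congr (Lnorm _ _ (EFin \o _)).
by apply/funext => z; rewrite /patch; case: ifP => // /set_mem/fg.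
Qed.

Lemma continuous_inL2 f : continuous f -> inL2 X f.
Proof.
move=> cf; split; last by rewrite L2normE// ltry.
by apply: measurable_funS (continuous_measurable_rV cf).
Qed.

End L2_space.

Section projection.
Context {R : realType} {n : nat}.
Local Notation V := 'rV[R]_n.
Variables (X : set V) (p : nat -> V -> R) (f : V -> R).
Hypotheses (cX : compact X) (cp : forall i, continuous (p i))
  (cf : continuous f) (p_free : lin_indep_L2 X p).
Local Notation ip := (ip X).

Definition lc N (a : 'cV[R]_N) (z : V) : R := \sum_(i < N) a i 0 * p i z.

Definition gram N : 'M[R]_N := \matrix_(i, j) ip (p i) (p j).

Definition moment N : 'cV[R]_N := \col_i ip (p i) f.

Definition sqdist N (a : 'cV[R]_N) : R :=
  ip (fun z => lc a z - f z) (fun z => lc a z - f z).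

Lemma continuous_lc N (a : 'cV[R]_N) : continuous (lc a).
Proof. exact: (continuous_lincomb (p := fun i : 'I_N => p i)). Qed.

Lemma ip_lcl N (a : 'cV[R]_N) g : continuous g ->
  ip (lc a) g = \sum_i a i 0 * ip (p i) g.
Proof.
move=> cg; exact: (@ip_suml _ _ _ cX 'I_N (index_enum _) (fun i => a i 0)
  (fun i : 'I_N => p i) g).
Qed.

Lemma ip_lcp N (a : 'cV[R]_N) (i : 'I_N) : ip (p i) (lc a) = (gram N *m a) i 0.
Proof.
rewrite ipC ip_lcl// mxE; apply: eq_bigr => j _.
by rewrite mxE mulrC ipC.
Qed.

Lemma sqdistE N (a : 'cV[R]_N) : sqdist a =
  \sum_i a i 0 * ((gram N *m a) i 0 - (moment N) i 0 *+ 2) + ip f f.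
Proof.
have ca := @continuous_lc N a; have caf := continuous_funB ca cf.
have -> : sqdist a = ip (lc a) (lc a) - ip (lc a) f *+ 2 + ip f f.
  rewrite /sqdist; set h := fun z => lc a z - f z.
  have hE g : continuous g -> ip h g = ip (lc a) g - ip f g by exact: ipBl.
  rewrite (hE _ caf) (ipC X (lc a) h) (ipC X f h) (hE _ ca) (hE _ cf).
  by rewrite (ipC X f (lc a)) mulr2n; ring.
rewrite !ip_lcl// -sumrMnl -sumrB; congr (_ + _); apply: eq_bigr => i _.
by rewrite ip_lcp [moment N i 0]mxE mulrBr mulrnAr.
Qed.

Lemma cvg_sqdist (I : Type) (D : set_system I) {FD : Filter D} N
    (a : I -> 'cV[R]_N) (b : 'cV[R]_N) :
  a t @[t --> D] --> b -> sqdist (a t) @[t --> D] --> sqdist b.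
Proof.
move=> ab; under eq_fun do rewrite sqdistE; rewrite sqdistE.
have acoef i : a t i 0 @[t --> D] --> b i 0 by move/cvg_mxP : ab; exact.
have Ga : gram N *m a t @[t --> D] --> gram N *m b.
  by apply: cvg_mulmx => //; exact: cvg_cst.
have Gcoef i : (gram N *m a t) i 0 @[t --> D] --> (gram N *m b) i 0.
  by move/cvg_mxP : Ga; exact.
apply: cvgD; last exact: cvg_cst.
apply: cvg_sumr => i _; apply: cvgM => //.
by apply: cvgB => //; exact: cvg_cst.
Qed.

Lemma gram_unit N : gram N \in unitmx.
Proof.
have/row_freeP[B BE] : row_free (gram N)^T; last first.
  by rewrite -unitmx_tr; have [] := mulmx1_unit BE.
apply/inj_row_free => u uG.
have Gu : gram N *m u^T = 0.
  by apply: trmx_inj; rewrite trmx_mul trmxK uG trmx0.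
have cu := @continuous_lc N u^T.
have ip0 : ip (lc u^T) (lc u^T) = 0.
  rewrite ip_lcl//; apply: big1 => i _.
  by rewrite ip_lcp Gu [X in _ * X]mxE mulr0.
have := @p_free N (fun i => u^T i 0).
rewrite (L2normE cX cu) ip0 sqrtr0 => /(_ erefl) u0.
by apply/rowP => i; have := u0 i; rewrite !mxE.
Qed.

(* [gram N *m a = moment N] are the normal equations of the projection of [f]. *)
Lemma sqdist_min N (a b : 'cV[R]_N) : gram N *m a = moment N ->
  sqdist a <= sqdist b.
Proof.
move=> Ga; rewrite !sqdistE lerD2r -subr_ge0.
have := ip_ge0 X (lc (b - a)); rewrite ip_lcl; last exact: continuous_lc.
under eq_bigr do rewrite ip_lcp mulmxBr.
suff -> : \sum_i (b - a) i 0 * (gram N *m b - gram N *m a) i 0 =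
   \sum_i b i 0 * ((gram N *m b) i 0 - moment N i 0 *+ 2) -
   \sum_i a i 0 * ((gram N *m a) i 0 - moment N i 0 *+ 2) by [].
have sym : \sum_i a i 0 * (gram N *m b) i 0 = \sum_i b i 0 * (gram N *m a) i 0.
  have ca := @continuous_lc N a; have cb := @continuous_lc N b.
  transitivity (ip (lc a) (lc b)).
    by rewrite ip_lcl//; apply: eq_bigr => i _; rewrite ip_lcp.
  by rewrite ipC ip_lcl//; apply: eq_bigr => i _; rewrite ip_lcp.
rewrite -Ga in sym *; rewrite -sumrB.
transitivity (\sum_i (b i 0 * (gram N *m b) i 0 - b i 0 * (gram N *m a) i 0
   - a i 0 * (gram N *m b) i 0 + a i 0 * (gram N *m a) i 0)).
  by apply: eq_bigr => i _; rewrite !mxE; ring.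
have s0 : \sum_i b i 0 * (gram N *m a) i 0 -
    \sum_i a i 0 * (gram N *m b) i 0 = 0 by rewrite sym subrr.
apply/eqP; rewrite -subr_eq0 -sumrB; apply/eqP; rewrite -[RHS]s0 -sumrB.
by apply: eq_bigr => i _; rewrite mulr2n; ring.
Qed.

Hypothesis p_dense : span_dense_L2 X p.

Lemma sqdist_to0 (a : forall N, 'cV[R]_N) :
  (forall N, gram N *m a N = moment N) ->
  (Num.sqrt (sqdist (a N)))%:E @[N --> \oo] --> (0%E : \bar R).
Proof.
move=> Ga; apply: cvg_EFin; first by apply: nearW.
apply/cvgr0Pnorm_le => e e0.
have [N0 [c ce]] := p_dense (continuous_inL2 cX cf) e0.
exists N0 => // N /= N0N; rewrite ger0_norm ?sqrtr_ge0//.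
pose g (i : nat) := if insub i is Some j then c j else 0.
pose b : 'cV[R]_N := \col_i g i.
have bE z : lc b z = \sum_(k < N0) c k * p k z.
  transitivity (\sum_(k < N0) g k * p k z); last first.
    by apply: eq_bigr => k _; rewrite /g valK.
  rewrite (big_ord_widen N (fun k => g k * p k z))// [RHS]big_mkcond.
  apply: eq_bigr => i _; rewrite mxE; case: ifPn => // iN0.
  by rewrite /g insubN// mul0r.
have cb := @continuous_lc N b.
have dE : L2norm X (fun z => f z - \sum_(k < N0) c k * p k z) =
    (Num.sqrt (sqdist b))%:E.
  transitivity (L2norm X (fun z => f z - lc b z)).
    by apply: eq_L2norm => z _; rewrite bE.
  rewrite L2normE//; last exact: continuous_funB.
  congr (Num.sqrt _)%:E; apply: eq_Rintegral => z _; ring.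
move: ce; rewrite dE lte_fin => /ltW; apply: le_trans.
by rewrite ler_wsqrtr// sqdist_min.
Qed.

End projection.

Section uniform_sample.
Context {R : realType} {n : nat} {d : measure_display}
  {Omega : measurableType d} (P : probability Omega R).
Local Notation V := 'rV[R]_n.
Local Notation mu := (lebesgue_rV n).
Variables (X : set V) (x : {RV P >-> V}).
Hypotheses (cX : compact X) (X_pos : (0 < mu X)%E)
  (x_unif : uniformly_distributed P X x).

Let m : R := fine (mu X).

Lemma volE : mu X = m%:E.
Proof.
rewrite /m fineK// ge0_fin_numE ?compact_lebesgue_fin//.
Qed.

Lemma vol_gt0 : 0 < m.
Proof. by move: X_pos; rewrite volE lte_fin. Qed.

Lemma uniform_null A : measurable A -> mu A = 0%E -> distribution P x A = 0%E.
Proof.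
move=> mA A0; rewrite x_unif// (_ : mu (A `&` X) = 0%E) ?mul0e//.
apply/eqP; rewrite eq_le measure_ge0 andbT -A0 le_measure ?inE//.
by apply: measurableI => //; exact: compact_measurable_rV.
Qed.

Lemma uniform_ae_notin A : measurable A -> mu A = 0%E ->
  {ae P, forall w, ~ A (x w)}.
Proof.
move=> mA A0; exists (x @^-1` A); split.
- exact: measurable_preimage.
- exact: (uniform_null mA A0).
- by move=> w /= /contrapT.
Qed.

Lemma uniform_ae_in : {ae P, forall w, X (x w)}.
Proof.
have mX : measurable X by exact: compact_measurable_rV.
exists (x @^-1` (~` X)); split => //.
- by apply: (@measurable_preimage _ _ _ _ _ P (fun=> x) 0%N); exact: measurableC.
- have := x_unif (measurableC mX); rewrite setICl measure0 mul0e.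
  by apply.
Qed.

Lemma uniform_integral (f : V -> R) : continuous f ->
  (\int[P]_w ((f \_ X) (x w))%:E = (m^-1 * \int[mu]_(z in X) f z)%:E)%E.
Proof.
move=> cf; have mX : measurable X by exact: compact_measurable_rV.
have m0 := vol_gt0.
have mf : measurable_fun X f by apply: measurable_funS (continuous_measurable_rV cf).
have mh : measurable_fun [set: V] (f \_ X) by exact/(measurable_restrictT _ mX).
have [C C0 fC] := compact_bounded_fun cX cf.
have hC z : `|(f \_ X) z| <= C.
  by rewrite /patch; case: ifP => [/set_mem/fC//|_]; rewrite normr0.
have -> : (\int[P]_w ((f \_ X) (x w))%:E =
    \int[distribution P x]_z ((f \_ X) z)%:E)%E.
  rewrite integral_distribution//; first exact/measurable_EFinP.
  apply: (@bounded_integrable _ _ _ P _ C); last by move=> w; exact: hC.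
  exact: measurableT_comp.
have -> : (\int[distribution P x]_z ((f \_ X) z)%:E =
    \int[distribution P x]_(z in X) (f z)%:E)%E.
  rewrite [RHS]integral_mkcond; apply: eq_integral => z _.
  by rewrite /patch; case: ifP.
have m1 : 0 <= m^-1 by rewrite invr_ge0 ltW.
rewrite (@eq_measure_integral _ _ _ _ (mscale (NngNum m1) mu)); last first.
  move=> A mA AX; have := x_unif mA; rewrite /mscale /= volE inver gt_eqF//.
  by rewrite (setIidl AX) muleC; exact.
have mE : measurable_fun X (fun z => (f z)%:E) by exact/measurable_EFinP.
have [mpos mneg] := (measurable_funepos mE, measurable_funeneg mE).
rewrite integralE !ge0_integral_mscale//=.
have intf := continuous_integrable cX cf.
rewrite -muleBr//; last first.
  by rewrite fin_num_adde_defl// fin_numN; exact: integrable_neg_fin_num.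
rewrite -integralE EFinM /Rintegral fineK//.
exact: (integrable_fin_num mX intf).
Qed.

End uniform_sample.

Section sample_asymptotics.
Context {R : realType} {n : nat} {d : measure_display}
  {Omega : measurableType d} (P : probability Omega R).
Local Notation V := 'rV[R]_n.
Local Notation mu := (lebesgue_rV n).
Variables (X : set V) (x : nat -> {RV P >-> V}).
Hypotheses (cX : compact X) (X_pos : (0 < mu X)%E)
  (x_unif : forall k, uniformly_distributed P X (x k))
  (x_indep : mutually_independent P x).

Lemma lln_ip (f g : V -> R) : continuous f -> continuous g ->
  {ae P, forall w, (\sum_(k < K) ((fun z => f z * g z) \_ X) (x k w)) / K%:R
    @[K --> \oo] --> (fine (mu X))^-1 * ip X f g}.
Proof.
move=> cf cg; have cfg := continuous_funM cf cg.
have mX : measurable X by exact: compact_measurable_rV.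
have [C C0 fC] := compact_bounded_fun cX cfg.
apply: (@strong_lln _ _ _ _ _ P x x_indep _ C).
- apply/(measurable_restrictT _ mX).
  by apply: measurable_funS (continuous_measurable_rV cfg).
- by move=> z; rewrite /patch; case: ifP => [/set_mem/fC//|_]; rewrite normr0.
- by move=> k; exact: uniform_integral.
Qed.

Lemma sample_stays (F : V -> V) (phi : R -> V -> V) :
  continuous F -> generates_flow F phi -> nonsingular_flow phi ->
  forward_invariant phi X \/ backward_invariant phi X ->
  {ae P, forall w, forall k, X (x k w) /\
    \forall T \near 0^'+, X (phi T (x k w))}.
Proof.
move=> cF gF ns inv; apply: ae_foralln => k.
have inX := uniform_ae_in cX (x_unif k).
case: inv => inv.
  apply: filterS inX => w Xw; split => //; near=> T.
  apply: (inv T); last by exists (x k w).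
  by near: T; exact: nbhs_right_gt.
have mE : measurable (exit_set phi X) by exact: (exit_set_measurable cF gF).
have nE := uniform_ae_notin cX (x_unif k) mE (exit_set_null cF gF ns cX inv).
by apply: filterS2 inX nE => w Xw nEw; split => //; exact: (notin_exit_set gF).
Unshelve. all: by end_near. Qed.

End sample_asymptotics.

Section sampling_period_limit.
Context {R : realType} {n : nat}.
Local Notation V := 'rV[R]_n.
Variables (X : set V) (F : V -> V) (phi : R -> V -> V) (p : nat -> V -> R)
  (z : nat -> V) (j : 'I_n) (l : nat).
Hypotheses (F_flow : generates_flow F phi)
  (dp : forall i v, differentiable (p i) v)
  (p_coord : forall v, p l v = v ord0 j)
  (z_stays : forall k, X (z k) /\ \forall T \near 0^'+, X (phi T (z k))).

Let q k := L2ext phi X (p k).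
Let y T k := phi T (z k).

Lemma L2ext_in k v : X v -> q k v = p k v.
Proof.
by move=> Xv; rewrite /q /L2ext; case: ifP => // _; rewrite /patch mem_set.
Qed.

Lemma right_derivative (g : R -> R) c : is_derive (0 : R) 1 g c ->
  T^-1 * (g T - g 0) @[T --> 0^'+] --> c.
Proof.
move=> [dg gc]; apply: cvg_dnbhs_at_right.
have : h^-1 *: (g (h *: 1 + 0) - g 0) @[h --> 0^'] --> 'D_1 g 0 by exact: dg.
rewrite gc; apply: cvg_trans; apply: near_eq_cvg; apply: nearW => h.
by rewrite addr0 [h *: 1]mulr1.
Qed.

Lemma observable_derivative i v : exists c : R,
  T^-1 * (p i (phi T v) - p i v) @[T --> 0^'+] --> c.
Proof.
have du := flow_deriv F_flow v 0.
have du' : differentiable (phi^~ v) (0 : R).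
  by apply/derivable1_diffP; case: du.
have dpu : derivable (p i \o phi^~ v) (0 : R) 1.
  by apply/derivable1_diffP; exact: differentiable_comp.
exists ('D_1 (p i \o phi^~ v) 0).
have := right_derivative (DeriveDef dpu erefl).
by rewrite /= (flow0 F_flow).
Qed.

Lemma coordinate_derivative v :
  T^-1 * (p l (phi T v) - p l v) @[T --> 0^'+] --> F v ord0 j.
Proof.
have := is_derive_coord j (flow_deriv F_flow v 0).
move=> /right_derivative; rewrite (flow0 F_flow).
by under eq_fun do rewrite -!p_coord.
Qed.

Lemma basis_mx_ext K N : basis_mx q K N z = basis_mx p K N z.
Proof.
by apply/matrixP => k i; rewrite !mxE L2ext_in//; case: (z_stays k).
Qed.

Variables (K N : nat).
Hypothesis lN : (l < N)%N.
Local Notation A := (basis_mx p K N z).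
Hypothesis uA : A^T *m A \in unitmx.

Lemma lifting_limit :
  (\forall T \near 0^'+, has_principal_log (koopman_mx q K N z (y T))) /\
  (\col_k w_hat q T K z (y T) l k : 'cV[R]_N) @[T --> 0^'+] -->
    Defs.pinv A *m (\col_k F (z k) ord0 j).
Proof.
pose D : 'M[R]_(K, N) :=
  \matrix_(k, i) projT1 (cid (observable_derivative i (z k))).
have DP : T^-1 *: (basis_mx q K N (y T) - A) @[T --> 0^'+] --> D.
  apply/cvg_mxP => k i; rewrite !mxE; case: cid => c /= cP.
  apply: cvg_trans cP; apply: near_eq_cvg.
  have [_ ] := z_stays k; apply: filterS => T XT.
  by rewrite !mxE L2ext_in.
have MD : T^-1 *: (koopman_mx q K N z (y T) - 1%:M) @[T --> 0^'+] -->
    Defs.pinv A *m D.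
  rewrite (_ : (fun T => _) = fun T => Defs.pinv A *m (T^-1 *: (basis_mx q K N (y T) - A))).
    by apply: cvg_mulmx => //; exact: cvg_cst.
  apply/funext => T; rewrite /koopman_mx basis_mx_ext -scalemxAr mulmxBr.
  by rewrite (pinv_mulmx_full_rank uA).
have [hlog logD] := mxlog_limit MD; split=> //.
have DE : D *m delta_mx (Ordinal lN) 0 = \col_k F (z k) ord0 j.
  rewrite -colE; apply/colP => k; rewrite !mxE; case: cid => c /= cP.
  rewrite -(cvg_lim (@Rhausdorff R) cP).
  apply: cvg_lim; first exact: Rhausdorff.
  exact: coordinate_derivative.
rewrite -DE mulmxA -colE; apply/cvg_mxP => k o; rewrite ord1 !mxE.
under eq_fun do rewrite mxE /w_hat insubT.
have/cvg_mxP/(_ k (Ordinal lN)) := logD.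
by rewrite mxE.
Qed.

End sampling_period_limit.

Section sample_size_limit.
Context {R : realType} {n : nat}.
Local Notation V := 'rV[R]_n.
Variables (X : set V) (p : nat -> V -> R) (f : V -> R) (z : nat -> V) (m : R)
  (N : nat).
Hypotheses (m0 : m != 0) (zX : forall k, X (z k))
  (gram_lln : forall i i', (\sum_(k < K) ((fun v => p i v * p i' v) \_ X) (z k))
     / K%:R @[K --> \oo] --> m * ip X (p i) (p i'))
  (moment_lln : forall i, (\sum_(k < K) ((fun v => p i v * f v) \_ X) (z k))
     / K%:R @[K --> \oo] --> m * ip X (p i) f)
  (gramU : gram X p N \in unitmx).

Local Notation A := (fun K => basis_mx p K N z).

Lemma sample_size_limit :
  (\forall K \near \oo, (A K)^T *m A K \in unitmx) /\
  Defs.pinv (A K) *m (\col_k f (z k)) @[K --> \oo] -->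
    invmx (gram X p N) *m moment X p f N.
Proof.
have patchX g k : (g \_ X) (z k) = g (z k) by rewrite /patch mem_set.
pose G K := K%:R^-1 *: ((A K)^T *m A K).
have GP : G K @[K --> \oo] --> m *: gram X p N.
  apply/cvg_mxP => i i'; rewrite !mxE; apply: cvg_trans (@gram_lln i i').
  apply: near_eq_cvg; apply: nearW => K; rewrite mulrC !mxE; congr (_ * _).
  by apply: eq_bigr => k _; rewrite patchX !mxE.
pose B K : 'cV[R]_N := K%:R^-1 *: ((A K)^T *m (\col_(k < K) f (z k))).
have BP : B K @[K --> \oo] --> m *: moment X p f N.
  apply/cvg_mxP => i o; rewrite ord1 !mxE; apply: cvg_trans (@moment_lln i).
  apply: near_eq_cvg; apply: nearW => K; rewrite mulrC !mxE; congr (_ * _).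
  by apply: eq_bigr => k _; rewrite patchX !mxE.
have mG : m *: gram X p N \in unitmx by rewrite unitmxZ// unitfE.
have Gunit : \forall K \near \oo, (0 < K)%N /\ G K \in unitmx.
  have d0 : \det (m *: gram X p N) != 0 by rewrite -unitfE -unitmxE.
  have cG : \det (G K) @[K --> \oo] --> \det (m *: gram X p N) by exact: cvg_det.
  have h : \forall K \near \oo, \det (G K) != 0 by apply: cvgr_neq0 d0.
  near=> K; split; first by near: K; exact: nbhs_infty_gt.
  by rewrite unitmxE unitfE; near: K.
have Aunit K : (0 < K)%N -> G K \in unitmx -> (A K)^T *m A K \in unitmx.
  by move=> K0; rewrite unitmxZ// unitfE invr_eq0 pnatr_eq0 -lt0n.
split; first by apply: filterS Gunit => K [K0 /Aunit]; exact.
have -> : invmx (gram X p N) *m moment X p f N =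
    invmx (m *: gram X p N) *m (m *: moment X p f N).
  by rewrite invmxZ// -scalemxAl -scalemxAr scalerA mulVf// scale1r.
apply: cvg_trans (cvg_mulmx (cvg_invmx mG GP) BP); apply: near_eq_cvg.
apply: filterS Gunit => K [K0 GK]; rewrite pinv_full_rank; last exact: Aunit.
rewrite invmxZ// invrK -scalemxAl -scalemxAr scalerA mulfV ?scale1r ?mulmxA//.
by rewrite pnatr_eq0 -lt0n.
Unshelve. all: by end_near. Qed.

End sample_size_limit.

Lemma cvg_EFin_sqrt {R : realType} (I : Type) (D : set_system I) {FD : Filter D}
    (a : I -> R) (b : R) : a t @[t --> D] --> b ->
  (Num.sqrt (a t))%:E @[t --> D] --> (Num.sqrt b)%:E.
Proof.
move=> ab; apply: cvg_EFin; first by apply: nearW.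
by apply: continuous_cvg ab; exact: sqrt_continuous.
Qed.

Lemma L2norm_F_hat {R : realType} {n : nat} (X : set 'rV[R]_n)
    (phi : R -> 'rV[R]_n -> 'rV[R]_n) (p : nat -> 'rV[R]_n -> R)
    (f : 'rV[R]_n -> R) (T : R) K N (z y : nat -> 'rV[R]_n) (l : nat) :
  compact X -> (forall i, continuous (p i)) -> continuous f ->
  let q k := L2ext phi X (p k) in
  L2norm X (fun v => F_hat q T K N z y l v - f v) =
  (Num.sqrt (sqdist X p f (\col_(k < N) w_hat q T K z y l k)))%:E.
Proof.
move=> cX cp cf q; set a := \col_k _.
transitivity (L2norm X (fun v => lc p a v - f v)).
  apply: eq_L2norm => v Xv; congr (_ - _); apply: eq_bigr => k _.
  by rewrite mxE /q L2ext_in.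
by rewrite L2normE//; apply: continuous_funB => //; exact: continuous_lc.
Qed.

Section monomials.
Context {R : realType} {n : nat} {d : measure_display}
  {Omega : measurableType d} (P : probability Omega R).
Local Notation V := 'rV[R]_n.
Variables (X : set V) (x : nat -> {RV P >-> V}) (p : nat -> V -> R)
  (alpha : nat -> {ffun 'I_n -> nat}).
Hypotheses (cX : compact X) (x_unif : forall k, uniformly_distributed P X (x k))
  (x_indep : mutually_independent P x) (alpha_bij : bijective alpha)
  (pE : forall k, p k = monomial (alpha k)).

Lemma monomial_sample_det N :
  {ae P, forall w, \det (\matrix_(k < N, i < N) p i (x k w)) != 0}.
Proof.
have cp i : continuous (p i) by rewrite pE; exact: continuous_monomial.
apply: (generic_rank x_indep); first by move=> i; exact: continuous_measurable_rV.
move=> r c k c0; case: alpha_bij => beta alphaK _.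
have sE : (fun z => \sum_(i < r.+1) c i * p i z) =
    (fun z => \sum_(m <- [seq alpha i | i <- iota 0 r.+1])
      c (inord (beta m)) * monomial m z).
  apply/funext => z; rewrite big_map -[iota 0 r.+1]/(index_iota 0 r.+1) big_mkord.
  by apply: eq_bigr => i _; rewrite alphaK inord_val pE.
have zE := congr1 (fun f : V -> R => [set z | f z = 0]) sE.
apply: (uniform_null cX (x_unif k)).
  apply: zero_set_measurable.
  exact: (continuous_lincomb (p := fun i : 'I_r.+1 => p i)).
rewrite {}zE; apply: (@polynomial_zero_set_null _ _ _ _ (alpha r)).
- by rewrite map_inj_uniq ?iota_uniq//; exact: can_inj alphaK.
- by apply: map_f; rewrite mem_iota /= add0n leqnn.
- by rewrite alphaK (_ : inord r = ord_max)//; apply/val_inj; rewrite /= inordK.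
Qed.

End monomials.

Section convergence.
Context {R : realType} {n : nat} {d : measure_display}
  {Omega : measurableType d} (P : probability Omega R).
Local Notation V := 'rV[R]_n.
Variables (F : V -> V) (phi : R -> V -> V) (X : set V) (x : nat -> {RV P >-> V})
  (p : nat -> V -> R) (l : 'I_n -> nat).
Hypotheses (F_cont : continuous F) (F_flow : generates_flow F phi)
  (phi_nonsing : nonsingular_flow phi) (X_compact : compact X)
  (X_pos : (0 < lebesgue_rV n X)%E)
  (X_inv : forward_invariant phi X \/ backward_invariant phi X)
  (x_unif : forall k, uniformly_distributed P X (x k))
  (x_indep : mutually_independent P x)
  (p_C1 : forall k, continuously_differentiable (p k))
  (p_coord : forall j z, p (l j) z = z ord0 j).

Let q k := L2ext phi X (p k).
Let xs omega k := x k omega.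
Let ys Ts omega k := phi Ts (x k omega).

Let dp i v : differentiable (p i) v.
Proof. by case: (p_C1 i). Qed.

Let cp i : continuous (p i).
Proof. by move=> v; exact: differentiable_continuous. Qed.

Let F_coord (j : 'I_n) : continuous (fun v => F v ord0 j).
Proof.
move=> v; exact: (cvg_comp _ _ (F_cont (x := v)) (@coord_continuous _ _ _ ord0 j (F v))).
Qed.

Lemma lifting_converges (p_free : lin_indep_L2 X p)
    (p_dense : span_dense_L2 X p) (j : 'I_n) : {ae P, forall omega,
  (\forall N \near \oo, \forall K \near \oo, \forall Ts \near 0^'+,
     has_principal_log (koopman_mx q K N (xs omega) (ys Ts omega))) /\
  iterated_lim (fun N K Ts => L2norm X (fun z =>
    F_hat q Ts K N (xs omega) (ys Ts omega) (l j) z - F z ord0 j)) 0%E}.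
Proof.
pose f v := F v ord0 j; have cf : continuous f by exact: F_coord.
pose m := (fine (lebesgue_rV n X))^-1.
have m0 : m != 0 by rewrite invr_eq0 gt_eqF// vol_gt0.
have stays := sample_stays X_compact x_unif F_cont F_flow phi_nonsing X_inv.
have gram_ae : {ae P, forall w, forall i i',
    (\sum_(k < K) ((fun v => p i v * p i' v) \_ X) (x k w)) / K%:R
      @[K --> \oo] --> m * ip X (p i) (p i')}.
  by apply: ae_foralln => i; apply: ae_foralln => i'; exact: lln_ip.
have moment_ae : {ae P, forall w, forall i,
    (\sum_(k < K) ((fun v => p i v * f v) \_ X) (x k w)) / K%:R
      @[K --> \oo] --> m * ip X (p i) f}.
  by apply: ae_foralln => i; exact: lln_ip.
apply: filterS3 stays gram_ae moment_ae => w stays gram_w moment_w.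
have zX k : X (xs w k) by case: (stays k).
have gu N : gram X p N \in unitmx by exact: gram_unit.
have Klim N := sample_size_limit m0 zX gram_w moment_w (gu N).
pose a K N := Defs.pinv (basis_mx p K N (xs w)) *m (\col_k f (xs w k)).
pose a' N := invmx (gram X p N) *m moment X p f N.
have Nl : \forall N \near \oo, (l j < N)%N by exact: nbhs_infty_gt.
have Tlim N K : (l j < N)%N ->
    (basis_mx p K N (xs w))^T *m basis_mx p K N (xs w) \in unitmx ->
    (\forall Ts \near 0^'+,
       has_principal_log (koopman_mx q K N (xs w) (ys Ts w))) /\
    (\col_k w_hat q Ts K (xs w) (ys Ts w) (l j) k : 'cV[R]_N)
      @[Ts --> 0^'+] --> a K N.
  by move=> lN uA; exact: (lifting_limit F_flow dp (p_coord j) stays lN uA).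
split.
  apply: filterS Nl => N lN; have [uA _] := Klim N.
  by apply: filterS uA => K uA; have [] := Tlim _ _ lN uA.
exists (fun N K => (Num.sqrt (sqdist X p f (a K N)))%:E).
exists (fun N => (Num.sqrt (sqdist X p f (a' N)))%:E); split.
- apply: filterS Nl => N lN; have [uA _] := Klim N.
  apply: filterS uA => K uA; have [_ aT] := Tlim _ _ lN uA.
  rewrite [X in X @ _](_ : _ = fun Ts => (Num.sqrt (sqdist X p f
      (\col_k w_hat q Ts K (xs w) (ys Ts w) (l j) k : 'cV[R]_N)))%:E); last first.
    by apply/funext => Ts; exact: L2norm_F_hat.
  by apply: cvg_EFin_sqrt; apply: cvg_sqdist.
- apply: nearW => N; have [_ aK] := Klim N.
  by apply: cvg_EFin_sqrt; apply: cvg_sqdist.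
- by apply: sqdist_to0 => // N; rewrite /a' mulKVmx.
Qed.

Lemma lifting_exact (alpha : nat -> {ffun 'I_n -> nat}) (w : nat -> V)
    (NF N K : nat) (j : 'I_n) :
  bijective alpha -> (forall k, p k = monomial (alpha k)) ->
  (forall z, F z = \sum_(k < NF) p k z *: w k) ->
  (NF <= N)%N -> (l j < N)%N -> (N <= K)%N -> {ae P, forall omega,
    (\forall Ts \near 0^'+,
       has_principal_log (koopman_mx q K N (xs omega) (ys Ts omega))) /\
    forall k : 'I_N, (k < NF)%N ->
      w_hat q Ts K (xs omega) (ys Ts omega) (l j) k @[Ts --> 0^'+]
        --> w k ord0 j}.
Proof.
move=> alpha_bij pE FE NFN lN NK.
have stays := sample_stays X_compact x_unif F_cont F_flow phi_nonsing X_inv.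
have det_ae := monomial_sample_det X_compact x_unif x_indep alpha_bij pE N.
apply: filterS2 stays det_ae => omega stays det0.
pose A := basis_mx p K N (xs omega).
have uA : A^T *m A \in unitmx.
  apply: gram_unitmx => v Av; move: det0.
  set S := (\matrix_(k, i) _) => det0.
  have uS : S \in unitmx by rewrite unitmxE unitfE.
  have Sv : S *m v = 0.
    apply/colP => k; have := congr1 (fun B : 'cV[R]_K => B (widen_ord NK k) 0) Av.
    rewrite !mxE => h; rewrite -[RHS]h; apply: eq_bigr => i _.
    by rewrite !mxE.
  by rewrite -(mulKmx uS v) Sv mulmx0.
have [hlog lim] := lifting_limit F_flow dp (p_coord j) stays lN uA.
split=> // k kNF.
pose c i := if (i < NF)%N then w i ord0 j else 0.
have FA : \col_(k < K) F (xs omega k) ord0 j = A *m (\col_(i < N) c i).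
  apply/colP => i; rewrite !mxE FE summxE (big_ord_widen N
    (fun k => (p k (xs omega i) *: w k) ord0 j))// big_mkcond.
  apply: eq_bigr => i' _; rewrite !mxE /c; case: ifP => // _.
  by rewrite mulr0.
move: lim; rewrite FA mulmxA pinv_mulmx_full_rank// mul1mx.
move=> /cvg_mxP/(_ k 0); rewrite mxE /c kNF.
by under eq_fun do rewrite mxE.
Qed.

End convergence.

Theorem theorem1 (R : realType) (n : nat)
    (F : 'rV[R]_n -> 'rV[R]_n) (phi : R -> 'rV[R]_n -> 'rV[R]_n)
    (X : set 'rV[R]_n)
    (d : measure_display) (Omega : measurableType d) (P : probability Omega R)
    (x : nat -> {RV P >-> 'rV[R]_n})
    (p : nat -> 'rV[R]_n -> R) (l : 'I_n -> nat)
    (F_cont : continuous F)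
    (F_flow : generates_flow F phi)
    (phi_inv : invertible_flow phi)
    (phi_nonsing : nonsingular_flow phi)
    (X_compact : compact X)
    (X_pos : (0 < lebesgue_rV n X)%E)
    (X_inv : forward_invariant phi X \/ backward_invariant phi X)
    (x_unif : forall k, uniformly_distributed P X (x k))
    (x_indep : mutually_independent P x)
    (p_C1 : forall k, continuously_differentiable (p k))
    (p_free : lin_indep_L2 X p)
    (p_dense : span_dense_L2 X p)
    (p_coord : forall j z, p (l j) z = z ord0 j) :
  let q k := L2ext phi X (p k) in
  let xs omega k := x k omega in
  let ys Ts omega k := phi Ts (x k omega) in
  (forall j : 'I_n, {ae P, forall omega,
     (\forall N \near \oo, \forall K \near \oo, \forall Ts \near 0^'+,
        has_principal_log (koopman_mx q K N (xs omega) (ys Ts omega))) /\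
     iterated_lim (fun N K Ts => L2norm X (fun z =>
       F_hat q Ts K N (xs omega) (ys Ts omega) (l j) z - F z ord0 j)) 0%E})
  /\
  (forall (alpha : nat -> {ffun 'I_n -> nat}) (mF : nat) (w : nat -> 'rV[R]_n),
     let NF := (((mF + n)`!) %/ (mF`! * n`!))%N in
     bijective alpha ->
     (forall k, p k = monomial (alpha k)) ->
     (forall k, (k < NF)%N = (total_degree (alpha k) <= mF)%N) ->
     (forall z, F z = \sum_(k < NF) p k z *: w k) ->
     forall N K : nat, (NF <= N)%N -> (forall j, (l j < N)%N) -> (N <= K)%N ->
     forall j : 'I_n, {ae P, forall omega,
       (\forall Ts \near 0^'+,
          has_principal_log (koopman_mx q K N (xs omega) (ys Ts omega))) /\
       forall k : 'I_N, (k < NF)%N ->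
         w_hat q Ts K (xs omega) (ys Ts omega) (l j) k @[Ts --> 0^'+]
           --> w k ord0 j}).
Proof.
move=> q xs ys; split.
  by move=> j; apply: (lifting_converges F_cont F_flow phi_nonsing X_compact
    X_pos X_inv x_unif x_indep p_C1 p_coord p_free p_dense).
move=> alpha mF w NF alpha_bij pE _ FE N K NFN lN NK j.
exact: (lifting_exact F_cont F_flow phi_nonsing X_compact X_inv x_unif x_indep
  p_C1 p_coord alpha_bij pE FE NFN (lN j) NK).
Qed.
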